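(* Let $(M,\mathcal Q)$ be an almost quaternionic manifold with twistor space $Z$. Among all the almost complex structures $I_1^{\nabla}$ on $Z$, where $\nabla$ ranges over all quaternionic connections on $(M,\mathcal Q)$, at most one is integrable; that is, if $\nabla,\nabla'$ are quaternionic connections such that $I_1^{\nabla}$ and $I_1^{\nabla'}$ are both integrable, then $I_1^{\nabla}=I_1^{\nabla'}$.
   Context: An almost quaternionic structure on a $4n$-dimensional manifold $M$ ($n\ge 1$) is a rank-3 subbundle $\mathcal Q\subset \mathrm{End}(TM)$ which is locally spanned by triples $(J_1,J_2,J_3)$ of almost complex structures with $J_\alpha^2=-\mathrm{id}$ and $J_1J_2=-J_2J_1=J_3$; such a local triple is called an admissible basis of $\mathcal Q$. $(M,\mathcal Q)$ is then called an almost quaternionic manifold. A quaternionic connection is a linear connection $\nabla$ on $TM$ preserving $\mathcal Q$, i.e. $\nabla_X\sigma\in\Gamma(\mathcal Q)$ for every vector field $X$ and every $\sigma\in\Gamma(\mathcal Q)$; no assumption is made on its torsion. Twistor space: $Z=\{J\in\mathcal Q: J^2=-\mathrm{id}\}$, i.e. the $S^2$-bundle $\pi:Z\to M$ whose elements are locally $J=a_1J_1+a_2J_2+a_3J_3$ with $a_1^2+a_2^2+a_3^2=1$. For $J\in Z$ with $\pi(J)=x$, the vertical space is $V_J=\ker \pi_{*}=\{W\in\mathcal Q_x: WJ+JW=0\}$. A quaternionic connection $\nabla$ induces a connection on the vector bundle $\mathcal Q$ which preserves $Z$, hence a horizontal distribution $H$ on $Z$ with $T_JZ=V_J\oplus H_J$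 and $\pi_*:H_J\to T_xM$ an isomorphism. For $Y\in T_xM$ let $Y^h\in H_J$ denote its horizontal lift. The almost complex structure $I_1^\nabla$ on $Z$ is defined at $J\in Z$ by $I_1^\nabla(W)=JW$ for $W\in V_J$ and $I_1^\nabla(Y^h)=(JY)^h$ for $Y\in T_xM$. An almost complex structure is called integrable if its Nijenhuis tensor $N_I(U,W)=[IU,IW]-[U,W]-I[IU,W]-I[U,IW]$ vanishes. *)

(* Defs.v *)
From HB Require Import structures.
From mathcomp Require Import all_boot all_order all_algebra.
From mathcomp Require Import all_classical all_reals all_analysis.
Set Implicit Arguments.
Unset Strict Implicit.
Unset Printing Implicit Defensive.
Import Order.TTheory GRing.Theory Num.Theory numFieldNormedType.Exports.
Local Open Scope classical_set_scope.
Local Open Scope ring_scope.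

Section SmoothCalculus.
Context {R : realType} {V W : normedModType R}.

(* Only used for finite-dimensional V and open S, where it is the usual
   notion of a C^k (resp. C^infinity) map. *)
Fixpoint Ck_on (k : nat) (S : set V) (f : V -> W) : Prop :=
  match k with
  | 0 => forall x, S x -> {for x, continuous f}
  | k'.+1 => (forall x, S x -> differentiable f x) /\
             (forall v : V, Ck_on k' S (fun x => 'D_v f x))
  end.

Definition smooth_on (S : set V) (f : V -> W) : Prop :=
  forall k, Ck_on k S f.

End SmoothCalculus.

(* The functions are total; cmap is only meaningful on cdom, and cinv on
   the image of cdom. *)
Record chart (R : realType) (m : nat) (T : topologicalType) := Chart {
  cdom : set T;
  cmap : T -> 'cV[R]_m;
  cinv : 'cV[R]_m -> T }.

Definition cimg (R : realType) (m : nat) (T : topologicalType)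
  (c : chart R m T) : set 'cV[R]_m := cmap c @` cdom c.

Record is_chart (R : realType) (m : nat) (T : topologicalType)
    (c : chart R m T) : Prop := IsChart {
  cdom_open : open (cdom c);
  cimg_open : open (cimg c);
  cmapK : forall x, cdom c x -> cinv c (cmap c x) = x;
  cmap_continuous : forall x, cdom c x -> {for x, continuous (cmap c)};
  cinv_continuous : forall u, cimg c u -> {for u, continuous (cinv c)} }.

(* A smooth manifold of dimension m, with an atlas indexed by the points:
   chart_at x is a chart around x, and all the transition maps between these
   charts are smooth.  (Any smooth structure is generated by such an atlas.) *)
Record manifold (R : realType) (m : nat) := Manifold {
  points :> topologicalType;
  chart_at : points -> chart R m points;
  chart_atP : forall x, is_chart (chart_at x);
  chart_at_dom : forall x, cdom (chart_at x) x;
  transition_smooth : forall x y,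
    smooth_on [set u | cimg (chart_at x) u /\
                       cdom (chart_at y) (cinv (chart_at x) u)]
      (cmap (chart_at y) \o cinv (chart_at x));
  manifold_hausdorff : hausdorff_space points;
  manifold_second_countable : @second_countable points }.

Section Manifold.
Context {R : realType} {m : nat} {M : manifold R m}.

Definition smooth_fun (U : set M) (f : M -> R) : Prop :=
  forall z : M, let c := chart_at z in
    smooth_on [set u | cimg c u /\ U (cinv c u)] (f \o cinv c).

(* The tangent space at x is identified with R^m by means of the
   distinguished chart at x; so v : 'cV_m is the tangent vector at x acting on
   functions as follows, and 'M_m (acting on columns) is End(T_x M).  As the
   chart depends on x, smoothness of a field is not smoothness of its
   columns; it is tested on functions (below). *)
Definition tderiv (x : M) (v : 'cV[R]_m) (f : M -> R) : R :=
  'D_v (f \o cinv (chart_at x)) (cmap (chart_at x) x).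

Definition smooth_vfield (U : set M) (X : M -> 'cV[R]_m) : Prop :=
  forall (V : set M) (f : M -> R), open V -> V `<=` U -> smooth_fun V f ->
    smooth_fun V (fun x => tderiv x (X x) f).

Definition smooth_endo (U : set M) (A : M -> 'M[R]_m) : Prop :=
  forall (V : set M) (X : M -> 'cV[R]_m), open V -> V `<=` U ->
    smooth_vfield V X -> smooth_vfield V (fun x => A x *m X x).

(* A linear connection as a covariant derivative: D x v Y stands for
   (nabla_v Y)(x), where v is a tangent vector at x and Y is a vector field
   defined and smooth around x (nothing is said about the value of D x v on a
   field that is not smooth around x).  The torsion is unconstrained. *)
Record linear_connection (D : M -> 'cV[R]_m -> (M -> 'cV[R]_m) -> 'cV[R]_m)
    : Prop := LinearConnection {
  conn_local : forall (U : set M) X Y, open U ->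
    smooth_vfield U X -> smooth_vfield U Y -> (forall y, U y -> X y = Y y) ->
    forall x v, U x -> D x v X = D x v Y;
  conn_linear : forall (U : set M) X, open U -> smooth_vfield U X ->
    forall x a v w, U x -> D x (a *: v + w) X = a *: D x v X + D x w X;
  conn_add : forall (U : set M) X Y, open U ->
    smooth_vfield U X -> smooth_vfield U Y ->
    forall x v, U x -> D x v (fun y => X y + Y y) = D x v X + D x v Y;
  conn_leibniz : forall (U : set M) f X, open U ->
    smooth_fun U f -> smooth_vfield U X -> forall x v, U x ->
    D x v (fun y => f y *: X y) = tderiv x v f *: X x + f x *: D x v X;
  conn_smooth : forall (U : set M) X Y, open U ->
    smooth_vfield U X -> smooth_vfield U Y ->
    smooth_vfield U (fun x => D x (X x) Y) }.

(* A = (nabla_v s)(x) for the induced connection on End(TM), where s is a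
   section of End(TM) that is smooth around x. *)
Definition endo_deriv (D : M -> 'cV[R]_m -> (M -> 'cV[R]_m) -> 'cV[R]_m)
    (x : M) (v : 'cV[R]_m) (s : M -> 'M[R]_m) (A : 'M[R]_m) : Prop :=
  forall (U : set M) (Y : M -> 'cV[R]_m), open U -> U x -> smooth_vfield U Y ->
    A *m Y x = D x v (fun y => s y *m Y y) - s x *m D x v Y.

Definition comb (J : 'I_3 -> M -> 'M[R]_m) (y : M) (a : 'rV[R]_3) : 'M[R]_m :=
  \sum_(i < 3) a 0 i *: J i y.

(* The indices 0, 1, 2 stand for the usual 1, 2, 3. *)
Record admissible_basis (Q : M -> set 'M[R]_m) (U : set M)
    (J : 'I_3 -> M -> 'M[R]_m) : Prop := AdmissibleBasis {
  adm_open : open U;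
  adm_smooth : forall i, smooth_endo U (J i);
  adm_sq : forall i y, U y -> J i y *m J i y = - 1%:M;
  adm_12 : forall y, U y -> J 0 y *m J 1 y = J 2 y;
  adm_21 : forall y, U y -> J 1 y *m J 0 y = - J 2 y;
  adm_span : forall y, U y -> Q y = range (comb J y) }.

Definition almost_quaternionic (Q : M -> set 'M[R]_m) : Prop :=
  forall x : M, exists U J, U x /\ admissible_basis Q U J.

Definition quaternionic_connection (Q : M -> set 'M[R]_m)
    (D : M -> 'cV[R]_m -> (M -> 'cV[R]_m) -> 'cV[R]_m) : Prop :=
  linear_connection D /\
  forall (U : set M) (s : M -> 'M[R]_m), open U -> smooth_endo U s ->
    (forall y, U y -> Q y (s y)) ->
    forall x v, U x -> exists2 A, Q x A & endo_deriv D x v s A.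

End Manifold.

Section Twistor.
Context {R : realType} {m : nat} {M : manifold R m}.
Variable Q : M -> set 'M[R]_m.

(* The pair (x, A) is the endomorphism A of T_x M.  The product topology of
   this type is irrelevant (and is not the one of the bundle End(TM)). *)
Local Notation endo_pt := (M * 'M[R]_m)%type.

Definition twistor : set endo_pt :=
  [set p | Q p.1 p.2 /\ p.2 *m p.2 = - 1%:M].

(* Topology and smooth structure of the twistor space as an S^2-bundle: an
   admissible basis J on U gives the trivialization
     U * S^2 -> Z,  (y, a) |-> a_1 J_1(y) + a_2 J_2(y) + a_3 J_3(y),
   and S^2 is described as the quotient of R^3 \ {0} by positive homotheties:
   a subset (a function) on U * S^2 is open (smooth) iff its pull-back to
   U * (R^3 \ {0}) by the radial projection is. *)
Definition sphere_pt (J : 'I_3 -> M -> 'M[R]_m) (y : M) (a : 'rV[R]_3)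
    : endo_pt :=
  (y, comb J y ((Num.sqrt (\sum_(i < 3) a 0 i ^+ 2))^-1 *: a)).

Definition twistor_open (O : set endo_pt) : Prop :=
  O `<=` twistor /\
  forall U J, admissible_basis Q U J ->
    open [set q : M * 'rV[R]_3 |
           [/\ U q.1, q.2 != 0 & O (sphere_pt J q.1 q.2)]].

Definition twistor_smooth (O : set endo_pt) (f : endo_pt -> R) : Prop :=
  forall U J, admissible_basis Q U J -> forall z : M, let c := chart_at z in
    smooth_on
      [set q : 'cV[R]_m * 'rV[R]_3 |
        [/\ cimg c q.1, U (cinv c q.1), q.2 != 0
          & O (sphere_pt J (cinv c q.1) q.2)]]
      (fun q : 'cV[R]_m * 'rV[R]_3 => f (sphere_pt J (cinv c q.1) q.2)).

Definition smooth_near (p : endo_pt) (f : endo_pt -> R) : Prop :=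
  exists O, [/\ twistor_open O, O p & twistor_smooth O f].

(* A tangent vector to Z at p is the operator of differentiation along a
   curve; it is set to be 0 on the functions that are not smooth near p, so
   that two tangent vectors at p are equal as soon as they agree on the
   functions that are smooth near p. *)
Local Notation tvec := ((endo_pt -> R) -> R).

Definition at_smooth (p : endo_pt) (v : tvec) : tvec :=
  fun f => if pselect (smooth_near p f) then v f else 0.

Definition curve_at (p : endo_pt) (g : R -> endo_pt) : Prop :=
  [/\ g 0 = p, \forall t \near (0 : R), twistor (g t)
    & forall f, smooth_near p f -> derivable (f \o g) 0 1].

Definition velocity (p : endo_pt) (g : R -> endo_pt) : tvec :=
  at_smooth p (fun f => (f \o g)^`()%classic 0).

Definition tangent (p : endo_pt) : set tvec :=
  [set velocity p g | g in curve_at p].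

Definition vertical (p : endo_pt) : set 'M[R]_m :=
  [set W | Q p.1 W /\ W *m p.2 + p.2 *m W = 0].

(* v is the element of ker(d pi) corresponding to the matrix W: the velocity
   of a curve B in the fibre over p.1, with B(0) = p.2 and B'(0) = W. *)
Definition is_vertical (p : endo_pt) (W : 'M[R]_m) (v : tvec) : Prop :=
  exists B : R -> 'M[R]_m, [/\ curve_at p (fun t => (p.1, B t)),
    is_derive (0 : R) (1 : R) B W & v = velocity p (fun t => (p.1, B t))].

(* v = s_* Y for a local section s of Z through p with nabla_Y s = 0. *)
Definition is_hlift (D : M -> 'cV[R]_m -> (M -> 'cV[R]_m) -> 'cV[R]_m)
    (p : endo_pt) (Y : 'cV[R]_m) (v : tvec) : Prop :=
  exists (U : set M) (s : M -> 'M[R]_m),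
    [/\ open U, U p.1 & smooth_endo U s] /\
    [/\ forall y, U y -> twistor (y, s y), s p.1 = p.2,
        endo_deriv D p.1 Y s 0
      & v = at_smooth p (fun f => tderiv p.1 Y (fun y => f (y, s y)))].

(* v' = JW + (JY)^h, where v = W + Y^h is the decomposition of v along
   T_J Z = V_J + H_J. *)
Definition I1_graph (D : M -> 'cV[R]_m -> (M -> 'cV[R]_m) -> 'cV[R]_m)
    (p : endo_pt) (v v' : tvec) : Prop :=
  exists W Y w h w' h', vertical p W /\
    [/\ is_vertical p W w, is_hlift D p Y h & v = w + h] /\
    [/\ is_vertical p (p.2 *m W) w', is_hlift D p (p.2 *m Y) h'
      & v' = w' + h'].

Definition I1 (D : M -> 'cV[R]_m -> (M -> 'cV[R]_m) -> 'cV[R]_m)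
    (p : endo_pt) (v : tvec) : tvec := get (I1_graph D p v).

Definition twistor_vfield (O : set endo_pt) (X : endo_pt -> tvec) : Prop :=
  (forall p, O p -> tangent p (X p)) /\
  forall O' f, twistor_open O' -> O' `<=` O -> twistor_smooth O' f ->
    twistor_smooth O' (fun p => X p f).

Definition bracket (X Y : endo_pt -> tvec) (p : endo_pt) : tvec :=
  at_smooth p (fun f => X p (fun q => Y q f) - Y p (fun q => X q f)).

Definition nijenhuis (I : endo_pt -> tvec -> tvec) (X Y : endo_pt -> tvec)
    (p : endo_pt) : tvec :=
  let IX q := I q (X q) in let IY q := I q (Y q) in
  bracket IX IY p - bracket X Y p - I p (bracket IX Y p) - I p (bracket X IY p).

Definition acs_integrable (I : endo_pt -> tvec -> tvec) : Prop :=
  forall O X Y, twistor_open O -> twistor_vfield O X -> twistor_vfield O Y ->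
    forall p, O p -> nijenhuis I X Y p = 0.

End Twistor.

(* Main.v *)
From HB Require Import structures.
Require Import Defs.
From mathcomp Require Import all_boot all_order all_algebra.
From mathcomp Require Import all_classical all_reals all_analysis.
From mathcomp Require Import ring lra.
Set Implicit Arguments.
Unset Strict Implicit.
Unset Printing Implicit Defensive.
Import Order.TTheory GRing.Theory Num.Theory numFieldNormedType.Exports.
Local Open Scope classical_set_scope.
Local Open Scope ring_scope.

(** Over a small open set of [M], a chart and an admissible basis [J] describe a
point of the twistor space by a pair [(u, a)], with [u] in R^m and [a] a unit
vector of R^3, and a tangent vector by a pair [(xi, eta)] with [eta] orthogonal
to [a].  Let [J_a] be the endomorphism [\sum_i a_i J_i] read in the chart, and
[Gamma] the connection form of the connection induced on the bundle [Q].  The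
horizontal lift of [xi] is [(xi, - Gamma(xi) a)], and the product with [J_a] is
the cross product with [a] on vertical vectors, so that

  [I_1 (xi, eta) = (J_a xi, a x eta + V xi)],
  [V xi = a x Gamma(xi) a - Gamma(J_a xi) a]

([I1_graphP], [I1_Tvec]): the connection enters [I_1] only through the linear
map [V].

The Nijenhuis tensor of [I_1] is evaluated on two fields [(xi, 0)] and
[(zeta, 0)] with constant coordinates, and only its component along the base is
kept ([nijenhuis_base]).  There the connection occurs only where the function
[J_a zeta] is differentiated along the fibre component [V xi] of [I_1 (xi, 0)],
or the same with [xi] and [zeta] exchanged; as [J_a] is linear in [a], the
component is [J_(V xi) zeta - J_(V zeta) xi] plus terms that depend only on the
chart and on [J].  If two connections give integrable structures, the
difference [v] of their maps [V] satisfies [J_(v xi) zeta = J_(v zeta) xi].  As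
[v] maps R^(4n) to R^3, it kills some [zeta <> 0]; then [J_(v xi) zeta = 0] for
every [xi], and [v xi = 0] because [J_b] has square [- |b|^2]
([I1_chart_uniq]).

Three facts make the coordinates legitimate.  Functions on the twistor space
can be tested in a single chart and a single admissible basis
([twistor_smooth_chart]), because two admissible bases differ by a smooth
family of isometries of R^3.  Vectors orthogonal to [a] can be applied to
functions of [(u, a)] without extending these by homogeneity to all [a <> 0]
([Tvec_coord]).  Finally second derivatives commute ([smooth_derive_swap]), so
that the bracket of two fields is the tangent vector with the expected
coordinates ([bracket_field]), to which [I_1] applies. *)

(** * Calculus of C^k maps *)

Section Calculus.
Context {R : realType}.
Implicit Types V W : normedModType R.

(** Differentiability depends on the germ only: the first order expansion of [f] at
[a] is one of [g]. *)
Lemma near_eq_differentiable V W (f g : V -> W) (a : V) :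
  {near a, f =1 g} -> differentiable f a -> differentiable g a.
Proof.
move=> fg df.
have [dc] := (diff_locallyP _ _).1 df => /eqaddoP fo.
have go : g \o shift a = cst (g a) + 'd f a +o_ (0 : V) id.
  apply/eqaddoP => e e0; move: (fo e e0) => fe.
  have fg0 : \forall h \near (0 : V), f (h + a) = g (h + a).
    by move: fg; rewrite (near_shift 0) /= subr0.
  near=> h.
  have <- : (f \o shift a - (cst (f a) + 'd f a)) h
          = (g \o shift a - (cst (g a) + 'd f a)) h.
    rewrite !fctE /= (nbhs_singleton fg).
    by rewrite (near fg0 h).
  by near: h.
have e := diff_unique dc go.
by apply/diff_locallyP; rewrite e.
Unshelve. all: by end_near. Qed.

Lemma derive_scalel V W (f : V -> W) (a : V) k v : differentiable f a ->
  'D_(k *: v) f a = k *: 'D_v f a.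
Proof. by move=> df; rewrite !deriveE // linearZ. Qed.

Lemma derive_addl V W (f : V -> W) (a : V) v w : differentiable f a ->
  'D_(v + w) f a = 'D_v f a + 'D_w f a.
Proof. by move=> df; rewrite !deriveE // linearD. Qed.

Lemma derive_suml V W (f : V -> W) (a : V) (I : finType) (k : I -> R)
    (v : I -> V) : differentiable f a ->
  'D_(\sum_i k i *: v i) f a = \sum_i k i *: 'D_(v i) f a.
Proof.
move=> df; rewrite deriveE // linear_sum; apply: eq_bigr => i _.
by rewrite linearZ deriveE.
Qed.

Lemma derive_comp V W (E : normedModType R) (f : V -> W) (g : W -> E) a v :
  differentiable f a -> differentiable g (f a) ->
  'D_v (g \o f) a = 'D_('D_v f a) g (f a).
Proof.
move=> df dg; have dc := differentiable_comp df dg.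
by rewrite !deriveE // diff_comp.
Qed.

Lemma derive_pair V W (E : normedModType R) (f : V -> W) (g : V -> E) a v :
  differentiable f a -> differentiable g a ->
  'D_v (fun x => (f x, g x)) a = ('D_v f a, 'D_v g a).
Proof.
move=> df dg; have dc := differentiable_pair df dg.
by rewrite !deriveE // diff_pair.
Qed.

Lemma derive_lin V W (l : {linear V -> W}) a v : continuous l ->
  'D_v l a = l v.
Proof.
by move=> lc; rewrite deriveE ?diff_lin //; exact: linear_differentiable.
Qed.

Lemma derive_sumf V W (I : finType) (f : I -> V -> W) (a v : V) :
  (forall i, differentiable (f i) a) ->
  differentiable (fun x => \sum_i f i x) a /\
  'D_v (fun x => \sum_i f i x) a = \sum_i 'D_v (f i) a.
Proof.
move=> df.
have -> : (fun x => \sum_i f i x) = \sum_(i <- index_enum I) f i.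
  by apply/funext => x; rewrite fct_sumE.
elim: (index_enum I) => [|i s [IH1 IH2]].
  rewrite !big_nil; split; first exact: (differentiable_cst 0).
  exact: (derive_cst 0).
rewrite !big_cons; split; first exact: differentiableD.
by rewrite deriveD ?IH2 //; apply: diff_derivable.
Qed.

Lemma derive_mulf V (f g : V -> R) a v :
  differentiable f a -> differentiable g a ->
  'D_v (fun x => f x * g x) a = f a * 'D_v g a + g a * 'D_v f a.
Proof. by move=> df dg; rewrite deriveM //; exact: diff_derivable. Qed.

Lemma sqrt_fun_diff V (f : V -> R) a v : differentiable f a -> 0 < f a ->
  differentiable (fun x => Num.sqrt (f x)) a /\
  'D_v (fun x => Num.sqrt (f x)) a = 2^-1 * ('D_v f a * (Num.sqrt (f a))^-1).
Proof.
move=> df fa0; have [ds es] := is_derive1_sqrt fa0.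
have dsq : differentiable Num.sqrt (f a) by apply/derivable1_diffP.
split; first exact: differentiable_comp df dsq.
rewrite (derive_comp v df dsq).
rewrite -[X in 'D_X _ _]mulr1 -[_ * 1]/(_ *: _) derive_scalel // es.
by rewrite invfM /GRing.scale /=; ring.
Qed.

Lemma inv_fun_diff V (f : V -> R) a v : differentiable f a -> f a != 0 ->
  differentiable (fun x => (f x)^-1) a /\
  'D_v (fun x => (f x)^-1) a = - ('D_v f a * ((f a)^-1 * (f a)^-1)).
Proof.
move=> df fa0; split; first exact: differentiableV.
rewrite deriveV //; last exact: diff_derivable.
by rewrite expr2 invfM scaleNr /GRing.scale /= mulrC.
Qed.

End Calculus.

Section Ck.
Context {R : realType}.
Implicit Types V W : normedModType R.

Lemma Ck_onW V W k S (f : V -> W) : Ck_on k.+1 S f -> Ck_on k S f.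
Proof.
elim: k f => [|k IH] f /=.
  by move=> [df _] x Sx; apply: differentiable_continuous; exact: df.
by move=> [df h]; split => // v; exact: IH (h v).
Qed.

(** Although [Ck_on] is meant for open sets, it is a conjunction of conditions at
the points of [S], hence it restricts to arbitrary subsets. *)
Lemma Ck_on_pt V W k S (f : V -> W) :
  Ck_on k S f <-> forall x, S x -> Ck_on k [set x] f.
Proof.
elim: k f => [|k IH] f /=.
  by split=> h x Sx; [move=> _ ->; exact: h | exact: h Sx _ erefl].
split=> [[h1 h2] x Sx|h].
  by split=> [_ ->|v]; [exact: h1 | exact: (IH _).1 (h2 v) _ Sx].
split=> [x Sx|v]; first by have [h1 _] := h x Sx; exact: h1.
by apply/IH => x Sx; have [_ h2] := h x Sx; exact: h2.
Qed.

Lemma Ck_on_sub V W k S T (f : V -> W) : T `<=` S -> Ck_on k S f -> Ck_on k T f.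
Proof. by move=> TS /Ck_on_pt h; apply/Ck_on_pt => x /TS; exact: h. Qed.

Lemma Ck_on_eq V W k S (f g : V -> W) : open S -> (forall x, S x -> f x = g x) ->
  Ck_on k S f -> Ck_on k S g.
Proof.
move=> oS; elim: k f g => [|k IH] f g fg /=.
  move=> h x Sx; have fgn : \near x, f x = g x.
    by apply: filterS fg _; exact: open_nbhs_nbhs.
  rewrite /prop_for /continuous_at -(fg _ Sx).
  by apply: cvg_trans (h x Sx); apply: near_eq_cvg.
have fgn x : S x -> \near x, f x = g x.
  by move=> Sx; apply: filterS fg _; exact: open_nbhs_nbhs.
move=> [h1 h2]; split=> [x Sx|v].
  exact: near_eq_differentiable (fgn _ Sx) (h1 x Sx).
apply: IH (h2 v) => x Sx.
exact: near_eq_derive (fgn _ Sx).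
Qed.

Lemma Ck_on_diff V W k S (f : V -> W) x : Ck_on k.+1 S f -> S x ->
  differentiable f x.
Proof. by case=> h _; exact: h. Qed.

Lemma Ck_on_cst V W k S (w : W) : Ck_on k S (fun _ : V => w).
Proof.
elim: k w => [|k IH] w /=; first by move=> x _; exact: cvg_cst.
split=> [x _|v]; first exact: (differentiable_cst w).
suff -> : (fun x : V => 'D_v (fun=> w) x) = fun=> 0 by exact: IH.
by apply/funext => x; exact: (derive_cst w).
Qed.

Lemma Ck_on_lin V W k S (l : {linear V -> W}) : continuous l -> Ck_on k S l.
Proof.
move=> lc; case: k => [|k] /=; first by move=> x _; exact: lc.
split=> [x _|v]; first exact: linear_differentiable.
suff -> : (fun x : V => 'D_v l x) = fun=> l v by exact: Ck_on_cst.
by apply/funext => x; exact: derive_lin.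
Qed.

Lemma Ck_on_lincomp V W (E : normedModType R) k S (f : V -> W)
    (l : {linear W -> E}) : continuous l -> open S ->
  Ck_on k S f -> Ck_on k S (fun x => l (f x)).
Proof.
move=> lc oS; elim: k f => [|k IH] f /=.
  by move=> h x Sx; apply: continuous_comp; [exact: h | exact: lc].
move=> [h1 h2]; have dl y : differentiable l y by exact: linear_differentiable.
split=> [x Sx|v]; first exact: differentiable_comp (h1 x Sx) (dl _).
apply: Ck_on_eq (IH _ (h2 v)) => // x Sx.
by rewrite (derive_comp v (h1 x Sx) (dl _)) derive_lin.
Qed.

Lemma Ck_on_add V W k S (f g : V -> W) : open S -> Ck_on k S f -> Ck_on k S g ->
  Ck_on k S (fun x => f x + g x).
Proof.
move=> oS; elim: k f g => [|k IH] f g /=.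
  by move=> hf hg x Sx; apply: continuousD; [exact: hf | exact: hg].
move=> [f1 f2] [g1 g2]; split=> [x Sx|v].
  by apply: differentiableD; [exact: f1 | exact: g1].
apply: Ck_on_eq (IH _ _ (f2 v) (g2 v)) => // x Sx.
by rewrite deriveD //; apply: diff_derivable; [exact: f1 | exact: g1].
Qed.

Lemma Ck_on_sum V W k S (I : finType) (f : I -> V -> W) : open S ->
  (forall i, Ck_on k S (f i)) -> Ck_on k S (fun x => \sum_i f i x).
Proof.
move=> oS h.
have -> : (fun x => \sum_i f i x) = \sum_(i <- index_enum I) f i.
  by apply/funext => x; rewrite fct_sumE.
elim: (index_enum I) => [|i s IH]; first by rewrite big_nil; exact: Ck_on_cst.
by rewrite big_cons; exact: Ck_on_add.
Qed.

Lemma Ck_on_mul V k S (f g : V -> R) : open S -> Ck_on k S f -> Ck_on k S g ->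
  Ck_on k S (fun x => f x * g x).
Proof.
move=> oS; elim: k f g => [|k IH] f g.
  by move=> hf hg x Sx; apply: continuousM; [exact: (hf x Sx) | exact: (hg x Sx)].
move=> hf hg; have [f1 f2] := hf; have [g1 g2] := hg; split=> [x Sx|v].
  by apply: differentiableM; [exact: f1 | exact: g1].
apply: (@Ck_on_eq _ _ _ _ (fun x => f x * 'D_v g x + g x * 'D_v f x)) => //.
  by move=> x Sx; rewrite derive_mulf //; [exact: f1 | exact: g1].
apply: Ck_on_add => //; first by apply: IH; [exact: Ck_onW hf | exact: g2].
by apply: IH; [exact: Ck_onW hg | exact: f2].
Qed.

Lemma Ck_on_opp V k S (f : V -> R) : open S -> Ck_on k S f ->
  Ck_on k S (fun x => - f x).
Proof.
move=> oS hf; apply: (@Ck_on_eq _ _ _ _ (fun x => (-1) * f x)) => //.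
  by move=> x _; rewrite mulN1r.
by apply: Ck_on_mul => //; exact: Ck_on_cst.
Qed.

(** The derivative of [1 / f] is a polynomial in [1 / f] and in the derivative of
[f], which makes the induction on [k] go through; [Ck_on_sqrt] is similar. *)
Lemma Ck_on_inv V k S (f : V -> R) : open S -> (forall x, S x -> f x != 0) ->
  Ck_on k S f -> Ck_on k S (fun x => (f x)^-1).
Proof.
move=> oS f0; elim: k => [|k IH].
  by move=> hf x Sx; apply: continuousV; [exact: f0 | exact: (hf x Sx)].
move=> hf; have [f1 f2] := hf; split=> [x Sx|v].
  by have [] := inv_fun_diff 0 (f1 x Sx) (f0 x Sx).
have {}IH := IH (Ck_onW hf).
apply: (@Ck_on_eq _ _ _ _ (fun x => - ('D_v f x * ((f x)^-1 * (f x)^-1)))) => //.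
  by move=> x Sx; have [_ ->] := inv_fun_diff v (f1 x Sx) (f0 x Sx).
apply: Ck_on_opp => //; apply: Ck_on_mul => //; first exact: f2.
exact: Ck_on_mul.
Qed.

Lemma Ck_on_sqrt V k S (f : V -> R) : open S -> (forall x, S x -> 0 < f x) ->
  Ck_on k S f -> Ck_on k S (fun x => Num.sqrt (f x)).
Proof.
move=> oS f0; elim: k => [|k IH].
  move=> hf x Sx; apply: continuous_comp; first exact: (hf x Sx).
  exact: sqrt_continuous.
move=> hf; have [f1 f2] := hf; split=> [x Sx|v].
  by have [] := sqrt_fun_diff 0 (f1 x Sx) (f0 x Sx).
have {}IH := IH (Ck_onW hf).
apply: (@Ck_on_eq _ _ _ _ (fun x => 2^-1 * ('D_v f x * (Num.sqrt (f x))^-1))) => //.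
  by move=> x Sx; have [_ ->] := sqrt_fun_diff v (f1 x Sx) (f0 x Sx).
apply: Ck_on_mul => //; first exact: Ck_on_cst.
apply: Ck_on_mul => //; first exact: f2.
by apply: Ck_on_inv => // x Sx; rewrite gt_eqF // sqrtr_gt0 f0.
Qed.

Lemma continuous_sumf V W (I : finType) (f : I -> V -> W) (a : V) :
  (forall i, {for a, continuous (f i)}) ->
  {for a, continuous (fun x => \sum_i f i x)}.
Proof.
move=> cf.
have -> : (fun x => \sum_i f i x) = \sum_(i <- index_enum I) f i.
  by apply/funext => x; rewrite fct_sumE.
elim: (index_enum I) => [|i s IH]; first by rewrite big_nil; exact: cvg_cst.
by rewrite big_cons; apply: continuousD; [exact: cf|exact: IH].
Qed.

(** The base [e] with coordinates [l] says that [W] is finite-dimensional.  The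
chain rule then reads [D_v (g o f) = \sum_i D_v (l_i o f) * (D_(e_i) g o f)],
in which only scalar functions occur, to which the induction hypothesis on [k]
applies. *)
Lemma Ck_on_comp V W (I : finType) (e : I -> W) (l : I -> {linear W -> R})
    (lc : forall i, continuous (l i)) (le : forall w, w = \sum_i l i w *: e i)
    k S T (f : V -> W) (g : W -> R) :
  open S -> (forall x, S x -> T (f x)) ->
  (forall i, Ck_on k S (fun x => l i (f x))) -> Ck_on k T g ->
  Ck_on k S (fun x => g (f x)).
Proof.
move=> oS ST; elim: k g => [|k IH] g.
  move=> hf hg x Sx; apply: continuous_comp; last by apply: (hg (f x)); exact: ST.
  have -> : f = fun x => \sum_i l i (f x) *: e i by apply/funext => y; exact: le.
  by apply: continuous_sumf => i; apply: cvgZr_tmp; exact: (hf i x Sx).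
move=> hf hg; have [g1 g2] := hg.
have df x : S x -> differentiable f x.
  move=> Sx.
  have -> : f = fun x => \sum_i l i (f x) *: e i by apply/funext => y; exact: le.
  have dfi i : differentiable (fun x => l i (f x) *: e i) x.
    by apply: differentiableZl; apply: (hf i).1.
  by have [] := derive_sumf 0 dfi.
split=> [x Sx|v].
  by apply: (differentiable_comp (df x Sx)); apply: g1; exact: ST.
apply: (@Ck_on_eq _ _ _ _
    (fun x => \sum_i 'D_v (fun x => l i (f x)) x * 'D_(e i) g (f x))) => //.
  move=> x Sx; rewrite (derive_comp v (df x Sx) (g1 _ (ST _ Sx))).
  rewrite [in RHS](le ('D_v f x)) derive_suml; last by apply: g1; exact: ST.
  apply: eq_bigr => i _.
  rewrite (_ : (fun x => l i (f x)) = l i \o f) // derive_comp ?derive_lin //.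
    exact: df.
  exact: linear_differentiable.
apply: Ck_on_sum => // i; apply: Ck_on_mul => //.
  by have [_ h] := hf i; exact: h.
apply: (IH (fun y => 'D_(e i) g y)); last exact: g2.
by move=> j; exact: Ck_onW (hf j).
Qed.

Lemma smooth_on_diff V W S (f : V -> W) x : smooth_on S f -> S x ->
  differentiable f x.
Proof. by move=> h; have := h 1%N => /Ck_on_diff; apply. Qed.

Lemma smooth_on_derive V W S (f : V -> W) v : smooth_on S f ->
  smooth_on S (fun x => 'D_v f x).
Proof. by move=> h k; have [_ d] := h k.+1; exact: d. Qed.

Lemma smooth_on_eq V W S (f g : V -> W) : open S ->
  (forall x, S x -> f x = g x) -> smooth_on S f -> smooth_on S g.
Proof. by move=> oS e h k; exact: Ck_on_eq e (h k). Qed.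

Lemma smooth_on_sub V W S T (f : V -> W) : T `<=` S -> smooth_on S f ->
  smooth_on T f.
Proof. by move=> ST h k; exact: Ck_on_sub ST (h k). Qed.

Lemma smooth_on_cst V W S (w : W) : smooth_on S (fun _ : V => w).
Proof. by move=> k; exact: Ck_on_cst. Qed.

Lemma smooth_on_add V W S (f g : V -> W) : open S -> smooth_on S f ->
  smooth_on S g -> smooth_on S (fun x => f x + g x).
Proof. by move=> oS hf hg k; exact: Ck_on_add. Qed.

Lemma smooth_on_mul V S (f g : V -> R) : open S -> smooth_on S f ->
  smooth_on S g -> smooth_on S (fun x => f x * g x).
Proof. by move=> oS hf hg k; exact: Ck_on_mul. Qed.

Lemma smooth_on_opp V S (f : V -> R) : open S -> smooth_on S f ->
  smooth_on S (fun x => - f x).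
Proof. by move=> oS hf k; exact: Ck_on_opp. Qed.

Lemma smooth_on_sum V W S (I : finType) (f : I -> V -> W) : open S ->
  (forall i, smooth_on S (f i)) -> smooth_on S (fun x => \sum_i f i x).
Proof. by move=> oS h k; apply: Ck_on_sum => // i; exact: h. Qed.

End Ck.

(** * Symmetry of second derivatives *)

Section Schwarz.
Context {R : realType} {V : normedModType R}.

Lemma is_diff_line (x v : V) (t : R) :
  is_diff t (fun s : R => x + s *: v) (fun s : R => s *: v).
Proof.
rewrite -[X in is_diff _ _ X]add0r.
have -> : (fun s : R => x + s *: v) = cst x + ( *:%R ^~ v) by [].
exact: is_diffD.
Qed.

Lemma derive_line (f : V -> R) x v (t : R) : differentiable f (x + t *: v) ->
  is_derive t (1 : R) (fun s : R => f (x + s *: v)) ('D_v f (x + t *: v)).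
Proof.
move=> df; have [dl el] := is_diff_line x v t.
have dc := differentiable_comp dl df.
apply: DeriveDef; first exact: (diff_derivable dc).
rewrite (derive_comp (1 : R) dl df) [X in 'D_X f _](deriveE _ dl) el.
by rewrite scale1r.
Qed.

(** The mean value theorem, first for the increment along [w] as a function on the
segment in the direction [v], then for the derivative along [v] on the segment
in the direction [w]. *)
Lemma second_difference (S : set V) (f : V -> R) (v w x : V) (h : R) :
  0 < h ->
  (forall s t : R, 0 <= s <= h -> 0 <= t <= h -> S (x + s *: v + t *: w)) ->
  (forall y, S y -> differentiable f y) ->
  (forall y, S y -> differentiable ('D_v f) y) ->
  exists s t : R, [/\ 0 <= s <= h, 0 <= t <= h &
    f (x + h *: v + h *: w) - f (x + h *: v) - (f (x + h *: w) - f x)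
    = h * (h * 'D_w ('D_v f) (x + s *: v + t *: w))].
Proof.
move=> h0 HS df ddf.
have h00 : 0 <= h <= h by rewrite lexx ltW.
have h0l : 0 <= (0 : R) <= h by rewrite lexx ltW.
pose g (s : R) := f ((x + h *: w) + s *: v) - f (x + s *: v).
have Sw s : 0 <= s <= h -> S ((x + h *: w) + s *: v).
  by move=> sh; rewrite addrAC; exact: HS.
have S0 s : 0 <= s <= h -> S (x + s *: v).
  by move=> sh; have := HS s 0 sh h0l; rewrite scale0r addr0.
have gd s : 0 <= s <= h -> is_derive s (1 : R) g
    ('D_v f ((x + h *: w) + s *: v) - 'D_v f (x + s *: v)).
  move=> sh; apply: is_deriveB; apply: derive_line; apply: df.
    exact: Sw.
  exact: S0.
have itvW s : s \in `]0, h[%R -> 0 <= s <= h.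
  by rewrite in_itv /= => /andP[/ltW -> /ltW ->].
have cont (k : R -> R) : (forall s, 0 <= s <= h -> {for s, continuous k}) ->
    {within `[0, h], continuous k}.
  move=> kc; apply: continuous_in_subspaceT => s; rewrite inE /= in_itv /=.
  exact: kc.
have [|s sh gE] := @MVT R g _ 0 h h0 (fun s sh => gd s (itvW s sh)).
  apply: cont => s /gd [gs _]; apply: differentiable_continuous.
  exact/derivable1_diffP.
pose k (t : R) := 'D_v f ((x + s *: v) + t *: w).
have {}sh := itvW _ sh.
have kd t : 0 <= t <= h -> is_derive t (1 : R) k
    ('D_w ('D_v f) ((x + s *: v) + t *: w)).
  by move=> th; apply: derive_line; apply: ddf; exact: HS.
have [|t th kE] := @MVT R k _ 0 h h0 (fun t th => kd t (itvW t th)).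
  apply: cont => t /kd [kt _]; apply: differentiable_continuous.
  exact/derivable1_diffP.
exists s, t; split=> //; first exact: itvW.
move: gE kE; rewrite /g /k !subr0 !scale0r !addr0.
rewrite [x + h *: w + s *: v]addrAC [x + h *: w + h *: v]addrAC => gE kE.
by rewrite [X in _ = h * X]mulrC -kE [RHS]mulrC -gE; ring.
Qed.

(** The second difference does not change when [v] and [w] are exchanged; so each
mixed derivative takes, near [x], a value that the other one also takes, and
both are continuous at [x]. *)
Lemma derive_swap (S : set V) (f : V -> R) (v w x : V) : open S -> S x ->
  (forall y, S y -> differentiable f y) ->
  (forall u y, S y -> differentiable ('D_u f) y) ->
  (forall u1 u2 y, S y -> {for y, continuous ('D_u1 ('D_u2 f))}) ->
  'D_v ('D_w f) x = 'D_w ('D_v f) x.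
Proof.
move=> oS Sx df ddf cf.
apply/eqP; rewrite -subr_eq0 -normr_le0; apply/ler_addgt0Pr => e e0.
rewrite add0r.
have e20 : 0 < e / 2 by rewrite divr_gt0.
pose P y := [/\ S y, `|'D_v ('D_w f) x - 'D_v ('D_w f) y| < e / 2 &
   `|'D_w ('D_v f) x - 'D_w ('D_v f) y| < e / 2].
have nP : nbhs x P.
  have n1 : \forall y \near x, `|'D_v ('D_w f) x - 'D_v ('D_w f) y| < e / 2.
    by move/cvgrPdist_lt: (cf v w x Sx); apply.
  have n2 : \forall y \near x, `|'D_w ('D_v f) x - 'D_w ('D_v f) y| < e / 2.
    by move/cvgrPdist_lt: (cf w v x Sx); apply.
  have n3 : nbhs x S by exact: open_nbhs_nbhs.
  by apply: filterS3 n3 n1 n2.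
have [d d0 dP] := (nbhs_ballP _ _).1 nP.
have d' : 0 < d by [].
(* The parallelogram with sides h v and h w lies in the ball of radius d. *)
pose h := d / (`|v| + `|w| + 1) / 2.
have den0 : 0 < `|v| + `|w| + 1 by rewrite ltr_wpDl // addr_ge0.
have h0 : 0 < h by rewrite divr_gt0 // divr_gt0.
have small s t : 0 <= s <= h -> 0 <= t <= h -> P (x + s *: v + t *: w).
  move=> /andP[s0 sh] /andP[t0 th]; apply: dP.
  rewrite -ball_normE /= -addrA opprD addrA subrr sub0r normrN.
  apply: le_lt_trans (ler_normD _ _) _; rewrite !normrZ !ger0_norm //.
  apply: (@le_lt_trans _ _ (h * (`|v| + `|w| + 1))).
    rewrite mulrDr mulr1 mulrDr; apply: ler_wpDr; first exact: ltW.
    by apply: lerD; apply: ler_wpM2r.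
  by rewrite /h mulrAC divfK ?gt_eqF // ltr_pdivrMr // ltr_pMr // ltr1n.
have [s [t [sh th E1]]] := second_difference h0
  (fun s t sh th => let: And3 a _ _ := small s t sh th in a) df (ddf v).
have [t' [s' [th' sh' E2]]] := @second_difference [set y | P y] f w v x h h0
  (fun t s th sh => eq_ind _ P (small s t sh th) _ (addrAC _ _ _))
  (fun y Py => let: And3 a _ _ := Py in df y a)
  (fun y Py => let: And3 a _ _ := Py in ddf w y a).
have E : 'D_w ('D_v f) (x + s *: v + t *: w)
       = 'D_v ('D_w f) (x + t' *: w + s' *: v).
  have hn0 : h != 0 by rewrite gt_eqF.
  apply: (mulfI hn0); apply: (mulfI hn0).
  have ac (p q r u : R) : p - q - (r - u) = p - r - (q - u) by ring.
  apply: (etrans (esym E1)); apply: (etrans _ E2).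
  by rewrite (addrAC x (h *: w) (h *: v)) ac.
have [_ _ b1] := small s t sh th.
have [_ b2 _] := small s' t' sh' th'.
rewrite [x + s' *: v + _]addrAC in b2.
have -> : 'D_v ('D_w f) x - 'D_w ('D_v f) x
  = ('D_v ('D_w f) x - 'D_v ('D_w f) (x + t' *: w + s' *: v))
    - ('D_w ('D_v f) x - 'D_w ('D_v f) (x + s *: v + t *: w)).
  rewrite E; move: ('D_v _ _) ('D_w _ _) ('D_v _ _) => a b c.
  by rewrite opprB addrA subrK.
apply: le_trans (ler_normB _ _) _.
by rewrite [leRHS]splitr; exact: (lerD (ltW b2) (ltW b1)).
Qed.

Lemma smooth_derive_swap (S : set V) (f : V -> R) (v w x : V) : open S ->
  smooth_on S f -> S x -> 'D_v ('D_w f) x = 'D_w ('D_v f) x.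
Proof.
move=> oS sf Sx; apply: (@derive_swap S f v w x oS Sx).
- by move=> y Sy; exact: smooth_on_diff sf Sy.
- by move=> u y Sy; exact: smooth_on_diff (smooth_on_derive u sf) Sy.
- move=> u1 u2 y Sy.
  have h := smooth_on_derive u1 (smooth_on_derive u2 sf).
  exact: (h 0%N y Sy).
Qed.

End Schwarz.

(** * Coordinates on R^m and on R^m x R^3 *)

Section Coordinates.
Context {R : realType}.

Definition cv_coord m (i : 'I_m) (w : 'cV[R]_m) : R := w i 0.

Lemma cv_coord_linear m i : linear (@cv_coord m i).
Proof. by move=> a v w; rewrite /cv_coord !mxE. Qed.

HB.instance Definition _ m i := GRing.isLinear.Build R 'cV[R]_m R _
  (@cv_coord m i) (@cv_coord_linear m i).

Lemma cv_coord_cont m i : continuous (@cv_coord m i).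
Proof. by move=> w; exact: coord_continuous. Qed.

Lemma cv_coordE m (w : 'cV[R]_m) :
  w = \sum_i cv_coord i w *: delta_mx i 0.
Proof.
apply/matrixP => i j; rewrite ord1 summxE (bigD1 i) //= big1.
  by rewrite !mxE !eqxx mulr1 addr0.
by move=> k ki; rewrite !mxE eq_sym (negbTE ki) mulr0.
Qed.

(** The index type is a sum so that the coordinates of R^m x R^p are handled as one
family. *)
Definition pair_coord m p (i : 'I_m + 'I_p) (q : 'cV[R]_m * 'rV[R]_p) : R :=
  match i with inl k => q.1 k 0 | inr k => q.2 0 k end.

Definition pair_base m p (i : 'I_m + 'I_p) : 'cV[R]_m * 'rV[R]_p :=
  match i with inl k => (delta_mx k 0, 0) | inr k => (0, delta_mx 0 k) end.

Lemma pair_coord_linear m p i : linear (@pair_coord m p i).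
Proof. by case: i => i a v w; rewrite /= !mxE. Qed.

HB.instance Definition _ m p i :=
  GRing.isLinear.Build R ('cV[R]_m * 'rV[R]_p)%type R _
  (@pair_coord m p i) (@pair_coord_linear m p i).

Lemma pair_coord_cont m p i : continuous (@pair_coord m p i).
Proof.
case: i => i w.
  apply: (@continuous_comp _ _ _ fst (fun u : 'cV[R]_m => u i 0)).
    exact: cvg_fst.
  exact: coord_continuous.
apply: (@continuous_comp _ _ _ snd (fun u : 'rV[R]_p => u 0 i)).
  exact: cvg_snd.
exact: coord_continuous.
Qed.

Lemma pair_coordE m p (w : 'cV[R]_m * 'rV[R]_p) :
  w = \sum_i pair_coord i w *: pair_base i.
Proof.
rewrite big_sumType /=.
apply: injective_projections; rewrite raddfD /= !raddf_sum /=.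
  rewrite [X in _ + X]big1 ?addr0; last by move=> i _; rewrite scaler0.
  exact: cv_coordE.
rewrite [X in X + _]big1 ?add0r; last by move=> i _; rewrite scaler0.
exact: row_sum_delta.
Qed.

Section Comp.
Context {V : normedModType R}.

Lemma smooth_on_comp_cv m S T (f : V -> 'cV[R]_m) (g : 'cV[R]_m -> R) :
  open S -> (forall x, S x -> T (f x)) ->
  (forall i, smooth_on S (fun x => f x i 0)) -> smooth_on T g ->
  smooth_on S (fun x => g (f x)).
Proof.
move=> oS ST hf hg k.
apply: (Ck_on_comp (@cv_coord_cont m) (@cv_coordE m) oS ST _ (hg k)) => i.
exact: hf.
Qed.

Lemma smooth_on_comp_pair m p S T (f1 : V -> 'cV[R]_m) (f2 : V -> 'rV[R]_p)
    (g : 'cV[R]_m * 'rV[R]_p -> R) :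
  open S -> (forall x, S x -> T (f1 x, f2 x)) ->
  (forall i, smooth_on S (fun x => f1 x i 0)) ->
  (forall i, smooth_on S (fun x => f2 x 0 i)) -> smooth_on T g ->
  smooth_on S (fun x => g (f1 x, f2 x)).
Proof.
move=> oS ST h1 h2 hg k.
apply: (Ck_on_comp (@pair_coord_cont m p) (@pair_coordE m p) oS ST _ (hg k)).
by case=> i; [exact: h1 | exact: h2].
Qed.

Lemma smooth_on_coord_cv m S (f : V -> 'cV[R]_m) i : open S -> smooth_on S f ->
  smooth_on S (fun x => f x i 0).
Proof.
by move=> oS hf k; exact: (Ck_on_lincomp (@cv_coord_cont m i) oS (hf k)).
Qed.

Lemma smooth_on_lin S (l : {linear V -> R}) : continuous l -> smooth_on S l.
Proof. by move=> lc k; exact: Ck_on_lin. Qed.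

Lemma differentiable_cv m (f : V -> 'cV[R]_m) x :
  (forall i, differentiable (fun y => f y i 0) x) -> differentiable f x.
Proof.
move=> df.
have -> : f = fun y => \sum_i f y i 0 *: delta_mx i 0.
  by apply/funext => y; exact: cv_coordE.
have dfi i : differentiable (fun y => f y i 0 *: (delta_mx i 0 : 'cV[R]_m)) x.
  exact: differentiableZl.
by have [] := derive_sumf 0 dfi.
Qed.

Lemma differentiable_rv m (f : V -> 'rV[R]_m) x :
  (forall i, differentiable (fun y => f y 0 i) x) -> differentiable f x.
Proof.
move=> df.
have -> : f = fun y => \sum_i f y 0 i *: delta_mx 0 i.
  by apply/funext => y; exact: row_sum_delta.
have dfi i : differentiable (fun y => f y 0 i *: (delta_mx 0 i : 'rV[R]_m)) x.
  exact: differentiableZl.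
by have [] := derive_sumf 0 dfi.
Qed.

Lemma derive_entry m p (f : V -> 'M[R]_(m, p)) x v i j : differentiable f x ->
  ('D_v f x) i j = 'D_v (fun y => f y i j) x.
Proof. by move=> df; rewrite derive_mx ?mxE //; exact: diff_derivable. Qed.

End Comp.

Lemma smooth_on_fst m p S (g : 'cV[R]_m -> R) : open S ->
  smooth_on [set u | exists a, S (u, a)] g ->
  smooth_on S (fun q : 'cV[R]_m * 'rV[R]_p => g q.1).
Proof.
move=> oS; apply: smooth_on_comp_cv => // [[u a] Sq|i]; first by exists a.
have h : smooth_on S (@pair_coord m p (inl i)).
  exact: (@smooth_on_lin _ S (@pair_coord m p (inl i)) (@pair_coord_cont m p (inl i))).
exact: h.
Qed.

Lemma smooth_on_snd m p S (j : 'I_p) :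
  smooth_on S (fun q : 'cV[R]_m * 'rV[R]_p => q.2 0 j).
Proof.
have h : smooth_on S (@pair_coord m p (inr j)).
  exact: (@smooth_on_lin _ S (@pair_coord m p (inr j)) (@pair_coord_cont m p (inr j))).
exact: h. Qed.

Lemma smooth_on_fst_coord m p S (i : 'I_m) :
  smooth_on S (fun q : 'cV[R]_m * 'rV[R]_p => q.1 i 0).
Proof.
have h : smooth_on S (@pair_coord m p (inl i)).
  exact: (@smooth_on_lin _ S (@pair_coord m p (inl i)) (@pair_coord_cont m p (inl i))).
exact: h.
Qed.

Lemma pair_coord_diff m p i q : differentiable (@pair_coord m p i) q.
Proof.
by case: i => i; [exact: (smooth_on_diff (@smooth_on_fst_coord m p setT i)) |
  exact: (smooth_on_diff (@smooth_on_snd m p setT i))].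
Qed.

Lemma derive_pair_coord m p i q w : 'D_w (@pair_coord m p i) q = pair_coord i w.
Proof. exact: (derive_lin q w (@pair_coord_cont m p i)). Qed.

Lemma derive_fst_coord m p (q w : 'cV[R]_m * 'rV[R]_p) i :
  'D_w (fun r : 'cV[R]_m * 'rV[R]_p => r.1 i 0) q = w.1 i 0.
Proof.
exact: (@derive_lin _ _ _ (@pair_coord m p (inl i)) q w
  (@pair_coord_cont m p (inl i))).
Qed.

Lemma derive_snd_coord m p (q w : 'cV[R]_m * 'rV[R]_p) i :
  'D_w (fun r : 'cV[R]_m * 'rV[R]_p => r.2 0 i) q = w.2 0 i.
Proof.
exact: (@derive_lin _ _ _ (@pair_coord m p (inr i)) q w
  (@pair_coord_cont m p (inr i))).
Qed.

End Coordinates.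

(** * Functions, vector fields and endomorphisms in a chart *)

Section Charts.
Context {R : realType} {m : nat} {M : manifold R m}.
Implicit Types (x y z : M) (U : set M).
Local Notation ch := (@chart_at R m M).

Lemma cinvK x u : cimg (ch x) u -> cdom (ch x) (cinv (ch x) u) /\
  cmap (ch x) (cinv (ch x) u) = u.
Proof. by move=> [y dy <-]; rewrite (cmapK (chart_atP x) dy). Qed.

Lemma cimg_cmap x y : cdom (ch x) y -> cimg (ch x) (cmap (ch x) y).
Proof. by move=> dy; exists y. Qed.

Definition chart_img x U : set 'cV[R]_m :=
  [set u | cimg (ch x) u /\ U (cinv (ch x) u)].

Lemma chart_img_open x U : open U -> open (chart_img x U).
Proof.
move=> oU; rewrite openE => u [iu Uu]; apply: filterI.
  by apply: open_nbhs_nbhs; split=> //; exact: (cimg_open (chart_atP x)).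
apply: (cinv_continuous (chart_atP x) iu).
by apply: open_nbhs_nbhs; split.
Qed.

Lemma cmap_chart_img x U y : cdom (ch x) y -> U y ->
  chart_img x U (cmap (ch x) y).
Proof.
move=> dy Uy; split; first exact: cimg_cmap.
by rewrite (cmapK (chart_atP x) dy).
Qed.

Lemma nbhs_cmap x U y : open U -> cdom (ch x) y -> U y ->
  nbhs (cmap (ch x) y) (chart_img x U).
Proof.
move=> oU dy Uy; apply: open_nbhs_nbhs; split; first exact: chart_img_open.
exact: cmap_chart_img.
Qed.

Definition transition x y := cmap (ch y) \o cinv (ch x).

Lemma transition_map_smooth x y :
  smooth_on (chart_img x (cdom (ch y))) (transition x y).
Proof. exact: transition_smooth. Qed.

Lemma transition_diff x y z : cdom (ch x) z -> cdom (ch y) z ->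
  differentiable (transition x y) (cmap (ch x) z).
Proof.
move=> dx dy; apply: (smooth_on_diff (@transition_map_smooth x y)).
exact: cmap_chart_img.
Qed.

Lemma transitionE x y z : cdom (ch x) z -> transition x y (cmap (ch x) z) = cmap (ch y) z.
Proof. by move=> dx; rewrite /transition /= (cmapK (chart_atP x) dx). Qed.

Lemma chart_dom_open x : open (cdom (ch x)).
Proof. exact: (cdom_open (chart_atP x)). Qed.

(** Smoothness is tested in the charts at all points; as the transition maps are
smooth, one chart whose domain contains [U] is enough. *)
Lemma smooth_fun_chart x U (f : M -> R) : open U -> U `<=` cdom (ch x) ->
  smooth_on (chart_img x U) (f \o cinv (ch x)) -> smooth_fun U f.
Proof.
move=> oU Ux sf z; have oz := @chart_img_open z U oU.
apply: (@smooth_on_eq _ _ _ _ (fun u => (f \o cinv (ch x)) (transition z x u))) => //.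
  by move=> u [iu Uu] /=; rewrite (cmapK (chart_atP x) (Ux _ Uu)).
apply: smooth_on_comp_cv sf => //.
  move=> u [iu Uu]; rewrite /transition /=; apply: cmap_chart_img => //; exact: Ux.
move=> i; apply: smooth_on_coord_cv => //.
by apply: smooth_on_sub (@transition_map_smooth z x) => u [iu /Ux].
Qed.

Lemma smooth_fun_diff x U (f : M -> R) y : smooth_fun U f ->
  cdom (ch x) y -> U y -> differentiable (f \o cinv (ch x)) (cmap (ch x) y).
Proof.
move=> sf dy Uy; apply: (smooth_on_diff (sf x)); exact: cmap_chart_img.
Qed.

Lemma smooth_fun_sub U V (f : M -> R) : V `<=` U -> smooth_fun U f ->
  smooth_fun V f.
Proof.
by move=> VU sf z; apply: smooth_on_sub (sf z) => u [iu /VU].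
Qed.

Lemma smooth_fun_add U (f g : M -> R) : open U -> smooth_fun U f ->
  smooth_fun U g -> smooth_fun U (fun x => f x + g x).
Proof.
move=> oU sf sg z.
exact: (smooth_on_add (@chart_img_open z U oU) (sf z) (sg z)).
Qed.

Lemma smooth_fun_mul U (f g : M -> R) : open U -> smooth_fun U f ->
  smooth_fun U g -> smooth_fun U (fun x => f x * g x).
Proof.
move=> oU sf sg z.
exact: (smooth_on_mul (@chart_img_open z U oU) (sf z) (sg z)).
Qed.

Lemma smooth_fun_cst U (a : R) : smooth_fun U (fun _ => a).
Proof. by move=> z; exact: smooth_on_cst. Qed.

Lemma smooth_fun_sum U (I : finType) (f : I -> M -> R) : open U ->
  (forall i, smooth_fun U (f i)) -> smooth_fun U (fun x => \sum_i f i x).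
Proof.
move=> oU sf z.
exact: (smooth_on_sum (@chart_img_open z U oU) (fun i => sf i z)).
Qed.

Lemma smooth_fun_eq U (f g : M -> R) : open U -> (forall x, U x -> f x = g x) ->
  smooth_fun U f -> smooth_fun U g.
Proof.
move=> oU e sf z; apply: smooth_on_eq (sf z); first exact: chart_img_open.
by move=> u [_ Uu] /=; exact: e.
Qed.

(** The tangent space at [z] is identified with R^m by the chart at [z]; hence
[jac z x z] passes from this identification to the frame of the chart at [x],
and [jac x z z] goes back. *)
Definition jac x y z : 'M[R]_m :=
  \matrix_(i, j) ('D_(delta_mx j 0) (transition x y) (cmap (ch x) z)) i 0.

Lemma jacE x y z v : cdom (ch x) z -> cdom (ch y) z ->
  'D_v (transition x y) (cmap (ch x) z) = jac x y z *m v.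
Proof.
move=> dx dy; rewrite {1}(cv_coordE v) derive_suml; last exact: transition_diff.
apply/matrixP => i j; rewrite ord1 summxE mxE; apply: eq_bigr => k _.
by rewrite !mxE mulrC.
Qed.

Lemma derive_chart x y z U v (f : M -> R) : open U -> U z ->
  cdom (ch x) z -> cdom (ch y) z ->
  differentiable (f \o cinv (ch y)) (cmap (ch y) z) ->
  'D_v (f \o cinv (ch x)) (cmap (ch x) z)
    = 'D_(jac x y z *m v) (f \o cinv (ch y)) (cmap (ch y) z).
Proof.
move=> oU Uz dx dy df.
have df' : differentiable (f \o cinv (ch y)) (transition x y (cmap (ch x) z)).
  by rewrite transitionE.
have -> : 'D_v (f \o cinv (ch x)) (cmap (ch x) z)
   = 'D_v ((f \o cinv (ch y)) \o transition x y) (cmap (ch x) z).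
  apply: near_eq_derive.
  have := nbhs_cmap (@chart_dom_open y) dx dy; apply: filterS => u [iu du] /=.
  by rewrite (cmapK (chart_atP y) du).
by rewrite (derive_comp v (transition_diff dx dy) df') transitionE // jacE.
Qed.

Lemma tderivE x y v (f : M -> R) : cdom (ch x) y ->
  differentiable (f \o cinv (ch x)) (cmap (ch x) y) ->
  tderiv y v f = 'D_(jac y x y *m v) (f \o cinv (ch x)) (cmap (ch x) y).
Proof.
by move=> dy df; exact: (derive_chart v openT I (chart_at_dom y) dy df).
Qed.

Lemma chart_coord_diff x y (i : 'I_m) : cdom (ch x) y ->
  differentiable ((fun z => cmap (ch x) z i 0) \o cinv (ch x)) (cmap (ch x) y).
Proof.
move=> dy; apply: (@near_eq_differentiable _ _ _ (fun u : 'cV[R]_m => u i 0)).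
  have := nbhs_cmap (@chart_dom_open x) dy dy; apply: filterS => u [iu _] /=.
  by rewrite (cinvK iu).2.
exact: (differentiable_coord (cmap (ch x) y) i 0).
Qed.

(** Coordinate functions read off the components of a vector. *)
Lemma derive_chart_coord x y v (i : 'I_m) : cdom (ch x) y ->
  'D_v ((fun z => cmap (ch x) z i 0) \o cinv (ch x)) (cmap (ch x) y) = v i 0.
Proof.
move=> dy; rewrite -[RHS]/(cv_coord i v).
rewrite -(derive_lin (cmap (ch x) y) v (@cv_coord_cont R m i)).
apply: near_eq_derive.
have := nbhs_cmap (@chart_dom_open x) dy dy; apply: filterS => u [iu _] /=.
by rewrite (cinvK iu).2.
Qed.

Lemma tderiv_chart_coord x y v (i : 'I_m) : cdom (ch x) y ->
  tderiv y v (fun z => cmap (ch x) z i 0) = (jac y x y *m v) i 0.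
Proof.
by move=> dy; rewrite (tderivE _ dy (chart_coord_diff i dy)) derive_chart_coord.
Qed.

Lemma smooth_chart_coord x (i : 'I_m) :
  smooth_fun (cdom (ch x)) (fun z => cmap (ch x) z i 0).
Proof.
apply: (smooth_fun_chart (x := x)) => //; first exact: chart_dom_open.
apply: (@smooth_on_eq _ _ _ _ (cv_coord i)).
- by apply: chart_img_open; exact: chart_dom_open.
- by move=> u [iu _] /=; rewrite (cinvK iu).2.
- apply: smooth_on_lin; exact: cv_coord_cont.
Qed.

(** Both sides are compared on the coordinate functions of the chart at [y], by
differentiating them in the chart at [y], then at [x], then at [y] again. *)
Lemma jacK x y z : cdom (ch x) z -> cdom (ch y) z ->
  jac x y z *m jac y x z = 1%:M.
Proof.
move=> dx dy; apply/matrixP => i j.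
have <- : (jac x y z *m jac y x z *m (delta_mx j 0 : 'cV_m)) i 0
        = (jac x y z *m jac y x z) i j.
  by rewrite -colE mxE.
rewrite -mulmxA -(derive_chart_coord (jac x y z *m _) i dy).
rewrite -(derive_chart _ (@chart_dom_open y) dy dx dy (chart_coord_diff i dy)).
rewrite -(derive_chart _ (@chart_dom_open y) dy dy dx); last first.
  exact: (smooth_fun_diff (smooth_chart_coord y i) dx dy).
by rewrite derive_chart_coord // !mxE andbT.
Qed.

Lemma smooth_vfield_eq U (X Y : M -> 'cV[R]_m) : (forall x, U x -> X x = Y x) ->
  smooth_vfield U X -> smooth_vfield U Y.
Proof.
move=> e sX V f oV VU sf.
by apply: smooth_fun_eq (sX V f oV VU sf) => // x /VU Ux; rewrite e.
Qed.

Lemma smooth_vfield_sub U V (X : M -> 'cV[R]_m) : V `<=` U ->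
  smooth_vfield U X -> smooth_vfield V X.
Proof. by move=> VU sX W f oW WV; apply: sX => // x /WV /VU. Qed.

Lemma smooth_endo_sub U V (J : M -> 'M[R]_m) : V `<=` U ->
  smooth_endo U J -> smooth_endo V J.
Proof. by move=> VU sX W f oW WV; apply: sX => // x /WV /VU. Qed.

Lemma smooth_vfield_add U (X Y : M -> 'cV[R]_m) :
  smooth_vfield U X -> smooth_vfield U Y ->
  smooth_vfield U (fun x => X x + Y x).
Proof.
move=> sX sY V f oV VU sf.
apply: smooth_fun_eq (smooth_fun_add oV (sX V f oV VU sf) (sY V f oV VU sf)) => //.
move=> x Vx; rewrite /tderiv derive_addl //.
exact: (smooth_fun_diff sf (chart_at_dom x) Vx).
Qed.

Lemma smooth_vfield_scale U (g : M -> R) (X : M -> 'cV[R]_m) :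
  smooth_fun U g -> smooth_vfield U X ->
  smooth_vfield U (fun x => g x *: X x).
Proof.
move=> sg sX V f oV VU sf.
apply: smooth_fun_eq
  (smooth_fun_mul oV (smooth_fun_sub VU sg) (sX V f oV VU sf)) => //.
move=> x Vx; rewrite /tderiv derive_scalel //.
exact: (smooth_fun_diff sf (chart_at_dom x) Vx).
Qed.

Lemma smooth_vfield0 U : smooth_vfield U (fun _ => 0 : 'cV[R]_m).
Proof.
move=> V f oV VU sf; apply: smooth_fun_eq (@smooth_fun_cst V 0) => // x _.
by rewrite /tderiv derive0.
Qed.

Lemma smooth_vfield_sum U (I : finType) (X : I -> M -> 'cV[R]_m) :
  (forall i, smooth_vfield U (X i)) ->
  smooth_vfield U (fun x => \sum_i X i x).
Proof.
move=> sX.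
suff h s : smooth_vfield U (fun x => \sum_(i <- s) X i x) by exact: h.
elim: s => [|i s IH].
  by apply: smooth_vfield_eq (@smooth_vfield0 U) => x _; rewrite big_nil.
apply: smooth_vfield_eq (smooth_vfield_add (sX i) IH) => x _.
by rewrite big_cons.
Qed.

(** Smoothness of a field is tested on functions; the test on the coordinate
functions of the chart yields the components. *)
Lemma smooth_vfield_comp x U (X : M -> 'cV[R]_m) i : open U ->
  U `<=` cdom (ch x) -> smooth_vfield U X ->
  smooth_fun U (fun y => (jac y x y *m X y) i 0).
Proof.
move=> oU Ux sX.
have sc := smooth_fun_sub Ux (smooth_chart_coord x i).
apply: smooth_fun_eq (sX U _ oU (@subset_refl _ U) sc) => // y /Ux dy.
exact: tderiv_chart_coord.
Qed.

(** The field with constant components [xi] in the chart at [x]. *)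
Definition chart_field x (xi : 'cV[R]_m) (y : M) : 'cV[R]_m := jac x y y *m xi.

Lemma chart_fieldE x xi y : cdom (ch x) y -> jac y x y *m chart_field x xi y = xi.
Proof. by move=> dy; rewrite mulmxA jacK ?mul1mx //; exact: chart_at_dom. Qed.

Lemma chart_field_smooth x xi : smooth_vfield (cdom (ch x)) (chart_field x xi).
Proof.
move=> V f oV Vx sf; apply: (@smooth_fun_chart x) => //.
apply: smooth_on_eq (smooth_on_derive xi (sf x)); first exact: chart_img_open.
move=> u [iu Vu] /=; have [_ uE] := cinvK iu.
have dy := Vx _ Vu.
by rewrite (tderivE _ dy (smooth_fun_diff sf dy Vu)) chart_fieldE // uE.
Qed.

Definition endo_chart x (J : M -> 'M[R]_m) (y : M) : 'M[R]_m :=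
  jac y x y *m J y *m jac x y y.

Lemma endo_chart_smooth x U J i j : open U -> U `<=` cdom (ch x) ->
  smooth_endo U J -> smooth_fun U (fun y => endo_chart x J y i j).
Proof.
move=> oU Ux sJ.
have sc := smooth_vfield_sub Ux (@chart_field_smooth x (delta_mx j 0)).
have := smooth_vfield_comp i oU Ux (sJ U _ oU (@subset_refl _ U) sc).
by apply: smooth_fun_eq => // y Uy; rewrite /chart_field !mulmxA -colE mxE.
Qed.

End Charts.

(** * Quaternion algebra *)

Section Quaternions.
Context {R : realType}.
Implicit Types a b c : 'rV[R]_3.

Lemma sum_ord3 (V : nmodType) (F : 'I_3 -> V) : \sum_i F i = F 0 + F 1 + F 2.
Proof.
rewrite !big_ord_recr big_ord0 /= add0r.
by congr (F _ + F _ + F _); apply: val_inj.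
Qed.

Lemma ord3P (P : 'I_3 -> Prop) : P 0 -> P 1 -> P 2 -> forall i, P i.
Proof.
move=> p0 p1 p2 [[|[|[|//]]] i3].
- by rewrite (_ : Ordinal i3 = 0) //; exact: val_inj.
- by rewrite (_ : Ordinal i3 = 1) //; exact: val_inj.
- by rewrite (_ : Ordinal i3 = 2) //; exact: val_inj.
Qed.

Definition dot a b : R := \sum_i a 0 i * b 0 i.

Definition cross a b : 'rV[R]_3 := \row_i
  (if i == 0 then a 0 1 * b 0 2 - a 0 2 * b 0 1
   else if i == 1 then a 0 2 * b 0 0 - a 0 0 * b 0 2
   else a 0 0 * b 0 1 - a 0 1 * b 0 0).

Lemma crossE a b : (cross a b 0 0 = a 0 1 * b 0 2 - a 0 2 * b 0 1) *
  (cross a b 0 1 = a 0 2 * b 0 0 - a 0 0 * b 0 2) *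
  (cross a b 0 2 = a 0 0 * b 0 1 - a 0 1 * b 0 0).
Proof. by rewrite !mxE. Qed.

Lemma dotE a b : dot a b = a 0 0 * b 0 0 + a 0 1 * b 0 1 + a 0 2 * b 0 2.
Proof. exact: sum_ord3. Qed.

Lemma dotC a b : dot a b = dot b a.
Proof. by rewrite !dotE; ring. Qed.

Lemma dotDl a b c : dot (a + b) c = dot a c + dot b c.
Proof. by rewrite !dotE !mxE; ring. Qed.

Lemma dotZl k a b : dot (k *: a) b = k * dot a b.
Proof. by rewrite !dotE !mxE; ring. Qed.

Lemma dotNl a b : dot (- a) b = - dot a b.
Proof. by rewrite !dotE !mxE; ring. Qed.

Lemma dot_cross a b : dot (cross a b) a = 0.
Proof. by rewrite !dotE !crossE; ring. Qed.

Lemma crossC a b : cross a b = - cross b a.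
Proof. by apply/rowP; apply: ord3P; rewrite [RHS]mxE !crossE; ring. Qed.

Lemma crossvv a : cross a a = 0.
Proof. by apply/rowP; apply: ord3P; rewrite [RHS]mxE !crossE; ring. Qed.

Lemma crossDr a b c : cross a (b + c) = cross a b + cross a c.
Proof. by apply/rowP; apply: ord3P; rewrite [RHS]mxE !crossE !mxE; ring. Qed.

Lemma crossZr k a b : cross a (k *: b) = k *: cross a b.
Proof. by apply/rowP; apply: ord3P; rewrite [RHS]mxE !crossE !mxE; ring. Qed.

Lemma dot_ge0 a : 0 <= dot a a.
Proof. by apply: sumr_ge0 => i _; rewrite -expr2 sqr_ge0. Qed.

Lemma dot_gt0 a : a != 0 -> 0 < dot a a.
Proof.
move=> a0; rewrite lt_neqAle dot_ge0 andbT eq_sym; apply: contra_neq a0 => h.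
apply/rowP => i; rewrite [RHS]mxE; apply/eqP; rewrite -[_ == _]sqrf_eq0 expr2; apply/eqP.
by apply: (psumr_eq0P _ h) => // j _; rewrite -expr2 sqr_ge0.
Qed.

Definition normalize a : 'rV[R]_3 := (Num.sqrt (dot a a))^-1 *: a.

Lemma normalize_unit a : a != 0 -> dot (normalize a) (normalize a) = 1.
Proof.
move=> /dot_gt0 a0; rewrite /normalize dotZl dotC dotZl mulrA -invfM -expr2.
by rewrite sqr_sqrtr ?ltW // mulVf // gt_eqF.
Qed.

Lemma normalize_id a : dot a a = 1 -> normalize a = a.
Proof. by move=> a1; rewrite /normalize a1 sqrtr1 invr1 scale1r. Qed.

Lemma unit_neq0 a : dot a a = 1 -> a != 0.
Proof.
move=> a1; apply/negP => /eqP a0; move: a1; rewrite a0 dotE !mxE => /eqP.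
by rewrite !mul0r !addr0 eq_sym oner_eq0.
Qed.

Lemma quaternion_product m (A B C I : 'M[R]_m) (a0 a1 a2 b0 b1 b2 : R) :
  A *m A = - I -> B *m B = - I -> C *m C = - I ->
  A *m B = C -> B *m A = - C -> B *m C = A -> C *m B = - A ->
  C *m A = B -> A *m C = - B ->
  (a0 *: A + a1 *: B + a2 *: C) *m (b0 *: A + b1 *: B + b2 *: C) =
  - ((a0 * b0 + a1 * b1 + a2 * b2) *: I) + ((a1 * b2 - a2 * b1) *: A
   + (a2 * b0 - a0 * b2) *: B + (a0 * b1 - a1 * b0) *: C).
Proof.
move=> AA BB CC AB BA BC CB CA AC.
rewrite !mulmxDl !mulmxDr -!scalemxAl -!scalemxAr AA BB CC AB BA BC CB CA AC.
apply/matrixP => i j; rewrite !mxE.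
move: (A i j) (B i j) (C i j) (I i j) => u v w t; ring.
Qed.

Variables (m : nat) (J : 'I_3 -> 'M[R]_m).
Hypotheses (m0 : (0 < m)%N) (Jsq : forall i, J i *m J i = - 1%:M)
  (J12 : J 0 *m J 1 = J 2) (J21 : J 1 *m J 0 = - J 2).

(** Agrees with [comb], at one point. *)
Definition quat a : 'M[R]_m := \sum_i a 0 i *: J i.

Lemma J_mul : (J 1 *m J 2 = J 0) * (J 2 *m J 1 = - J 0) *
  (J 2 *m J 0 = J 1) * (J 0 *m J 2 = - J 1).
Proof.
have n12 : J 2 = - (J 1 *m J 0) by rewrite J21 opprK.
split; [split; [split|]|].
- by rewrite n12 mulmxN mulmxA Jsq mulNmx mul1mx opprK.
- by rewrite -J12 -mulmxA Jsq mulmxN mulmx1.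
- by rewrite n12 mulNmx -mulmxA Jsq mulmxN mulmx1 opprK.
- by rewrite -J12 mulmxA Jsq mulNmx mul1mx.
Qed.

Lemma quat_mul a b : quat a *m quat b = - (dot a b)%:M + quat (cross a b).
Proof.
rewrite /quat !sum_ord3 dotE !crossE -scalemx1.
by apply: quaternion_product; rewrite ?J_mul.
Qed.

Lemma quatD a b : quat (a + b) = quat a + quat b.
Proof.
by rewrite /quat -big_split; apply: eq_bigr => i _; rewrite mxE scalerDl.
Qed.

Lemma quatZ k a : quat (k *: a) = k *: quat a.
Proof.
by rewrite /quat scaler_sumr; apply: eq_bigr => i _; rewrite mxE scalerA.
Qed.

(** Each [J_k] is a product [A *m B = - B *m A], hence has trace 0. *)
Lemma trace_J i j : \tr (J i *m J j) = - (i == j)%:R * m%:R.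
Proof.
have tr0 k : \tr (J k) = 0.
  have h A B : A *m B = J k -> B *m A = - J k -> \tr (J k) = 0.
    move=> e1 e2; have := mxtrace_mulC A B; rewrite e1 e2 raddfN => /eqP.
    by rewrite -subr_eq0 opprK -mulr2n mulrn_eq0 /= => /eqP.
  by elim/ord3P: k h => h; [apply: (h (J 1) (J 2))|apply: (h (J 2) (J 0))|
    apply: (h (J 0) (J 1))]; rewrite ?J_mul.
have [<-|] := eqVneq i j; first by rewrite Jsq (raddfN (@mxtrace R m)) /= mxtrace1 mulN1r.
by elim/ord3P: i; elim/ord3P: j => // _; rewrite ?J_mul ?J12 ?J21 ?raddfN /=
  ?tr0 ?oppr0 ?mul0r.
Qed.

(** The [J_i] are orthogonal for the trace form.  This expression of the coefficients
makes sense for every matrix and is linear in it, so that it preserves smoothness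
and derivatives. *)
Definition coef (A : 'M[R]_m) : 'rV[R]_3 := \row_i - (\tr (A *m J i) / m%:R).

Lemma coefK a : coef (quat a) = a.
Proof.
have mn0 : m%:R != 0 :> R by rewrite pnatr_eq0 -lt0n.
apply/rowP => i; rewrite mxE /quat mulmx_suml raddf_sum (bigD1 i) //= big1.
  by rewrite -scalemxAl mxtraceZ trace_J eqxx addr0 mulN1r mulrN mulNr opprK mulfK.
by move=> k ki; rewrite -scalemxAl mxtraceZ trace_J (negbTE ki) oppr0 mul0r mulr0.
Qed.

Lemma quat_sq1 a : quat a *m quat a = - 1%:M <-> dot a a = 1.
Proof.
rewrite quat_mul crossvv.
have -> : quat 0 = 0 by rewrite /quat big1 // => i _; rewrite mxE scale0r.
rewrite addr0; split=> [/oppr_inj h|->//].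
by have /matrixP/(_ (Ordinal m0) (Ordinal m0)) := h; rewrite !mxE eqxx.
Qed.

End Quaternions.

(** * The connection induced on the quaternionic bundle *)

Lemma mulmx_cv_inj (R : realType) m (A B : 'M[R]_m) :
  (forall v : 'cV[R]_m, A *m v = B *m v) -> A = B.
Proof.
move=> h; apply/matrixP => i j.
by have /matrixP/(_ i 0) := h (delta_mx j 0); rewrite -!colE !mxE.
Qed.

Lemma mulmx_delta (R : pzSemiRingType) m p (A : 'M[R]_(m, p)) i j :
  (A *m (delta_mx j 0 : 'cV_p)) i 0 = A i j.
Proof. by rewrite -colE mxE. Qed.

Lemma mxtrace_conj (R : comNzRingType) m (L L' A B : 'M[R]_m) : L' *m L = 1%:M ->
  \tr (L *m A *m L' *m (L *m B *m L')) = \tr (A *m B).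
Proof.
move=> e; have -> : L *m A *m L' *m (L *m B *m L') = L *m (A *m B *m L').
  by rewrite !mulmxA -[L *m A *m L' *m L]mulmxA e mulmx1.
by rewrite mxtrace_mulC -(mulmxA (A *m B)) e mulmx1.
Qed.

Section Connection.
Context {R : realType} {m : nat} {M : manifold R m}.
Local Notation ch := (@chart_at R m M).
Local Notation conn := (M -> 'cV[R]_m -> (M -> 'cV[R]_m) -> 'cV[R]_m).

Section Linear.
Variable D : conn.
Hypothesis lD : linear_connection D.

Lemma conn0 U y v : open U -> U y -> D y v (fun _ => 0) = 0.
Proof.
move=> oU Uy; have s0 := @smooth_vfield0 R m M U.
have := conn_add lD oU s0 s0 v Uy; rewrite addr0 => /eqP.
by rewrite -subr_eq0 opprD addrA subrr sub0r oppr_eq0 => /eqP.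
Qed.

Lemma conn_sum U y v (I : finType) (X : I -> M -> 'cV[R]_m) : open U ->
  (forall i, smooth_vfield U (X i)) -> U y ->
  D y v (fun z => \sum_i X i z) = \sum_i D y v (X i).
Proof.
move=> oU sX Uy.
suff h s : smooth_vfield U (fun z => \sum_(i <- s) X i z) /\
    D y v (fun z => \sum_(i <- s) X i z) = \sum_(i <- s) D y v (X i).
  by have [] := h (index_enum I).
elim: s => [|i s [IH1 IH2]].
  rewrite big_nil (_ : (fun z => _) = fun=> 0); last first.
    by apply/funext => z; rewrite big_nil.
  by split; [exact: smooth_vfield0 | exact: conn0 oU Uy].
rewrite big_cons (_ : (fun z => _) = fun z => X i z + \sum_(j <- s) X j z).
  by split; [exact: (smooth_vfield_add (sX i) IH1) | rewrite (conn_add lD oU (sX i) IH1 v Uy) IH2].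
by apply/funext => z; rewrite big_cons.
Qed.

Lemma conn_scale U y v (k : R) (X : M -> 'cV[R]_m) : open U ->
  smooth_vfield U X -> U y -> D y v (fun z => k *: X z) = k *: D y v X.
Proof.
move=> oU sX Uy.
rewrite (conn_leibniz lD oU (@smooth_fun_cst _ _ _ U k) sX) //.
by rewrite /tderiv (derive_cst k) scale0r add0r.
Qed.

(** Leibniz rule for the connection induced on End(TM). *)
Lemma endo_deriv_comb U y v (I : finType) (s : I -> M -> R)
    (J A : I -> M -> 'M[R]_m) : open U -> U y ->
  (forall i, smooth_fun U (s i)) -> (forall i, smooth_endo U (J i)) ->
  (forall i, endo_deriv D y v (J i) (A i y)) ->
  endo_deriv D y v (fun z => \sum_i s i z *: J i z)
    (\sum_i (tderiv y v (s i) *: J i y + s i y *: A i y)).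
Proof.
move=> oU Uy ss sJ dJ W Y oW Wy sY.
have oUW : open (U `&` W) by exact: openI.
have sY' := smooth_vfield_sub (@subIsetr _ U W) sY.
have sJY i := sJ i _ _ oUW (@subIsetl _ U W) sY'.
have ss' i := smooth_fun_sub (@subIsetl _ U W) (ss i).
rewrite (_ : (fun z => _ *m _) = fun z => \sum_i s i z *: (J i z *m Y z)).
  rewrite (conn_sum _ oUW (fun i => smooth_vfield_scale (ss' i) (sJY i))) //.
  rewrite !mulmx_suml -sumrB; apply: eq_bigr => i _.
  rewrite (conn_leibniz lD oUW (ss' i) (sJY i)) // mulmxDl -!scalemxAl.
  rewrite (dJ i _ _ oW Wy sY) scalerBr addrA; by [].
apply/funext => z; rewrite mulmx_suml; apply: eq_bigr => i _.
by rewrite scalemxAl.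
Qed.

(** The coordinate fields span each tangent space. *)
Lemma endo_deriv_uniq x y v (s : M -> 'M[R]_m) A B : cdom (ch x) y ->
  endo_deriv D y v s A -> endo_deriv D y v s B -> A = B.
Proof.
move=> dy hA hB; apply: mulmx_cv_inj => w.
have -> : w = chart_field x (jac y x y *m w) y.
  by rewrite /chart_field mulmxA jacK ?mul1mx //; exact: chart_at_dom.
have sc := @chart_field_smooth R m M x (jac y x y *m w).
by rewrite (hA _ _ (@chart_dom_open _ _ _ x) dy sc) (hB _ _ (@chart_dom_open _ _ _ x) dy sc).
Qed.

End Linear.

Section Quaternionic.
Hypothesis m0 : (0 < m)%N.
Variables (Q : M -> set 'M[R]_m) (D : conn).
Hypothesis hD : quaternionic_connection Q D.
Variables (x0 : M) (U : set M) (J : 'I_3 -> M -> 'M[R]_m).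
Hypotheses (aJ : admissible_basis Q U J) (Ux : U `<=` cdom (ch x0)).

Let lD : linear_connection D. Proof. by case: hD. Qed.
Let oU : open U. Proof. exact: (adm_open aJ). Qed.

Local Notation Jy y := (fun i => J i y).

Lemma adm_quat_mul y a b : U y ->
  comb J y a *m comb J y b = - (dot a b)%:M + comb J y (cross a b).
Proof.
move=> Uy; apply: (@quat_mul R m (Jy y)).
- by move=> i; exact: (adm_sq aJ).
- exact: (adm_12 aJ).
- exact: (adm_21 aJ).
Qed.

Lemma adm_coefK y a : U y -> coef (Jy y) (comb J y a) = a.
Proof.
move=> Uy; apply: (@coefK R m (Jy y)) => //.
- by move=> i; exact: (adm_sq aJ).
- exact: (adm_12 aJ).
- exact: (adm_21 aJ).
Qed.

Lemma adm_combK y A : U y -> Q y A -> comb J y (coef (Jy y) A) = A.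
Proof.
by move=> Uy; rewrite (adm_span aJ) // => -[a _ <-]; rewrite adm_coefK.
Qed.

Lemma adm_comb y a : U y -> Q y (comb J y a).
Proof. by move=> Uy; rewrite (adm_span aJ) //; exists a. Qed.

Lemma comb_delta y i : comb J y (delta_mx 0 i) = J i y.
Proof.
rewrite /comb (bigD1 i) //= big1 ?addr0 ?mxE ?eqxx ?scale1r //.
by move=> k ki; rewrite mxE (negbTE ki) andbF scale0r.
Qed.

(** The matrix that [endo_deriv D y v (J j)] determines, computed from its values on
the coordinate fields; the last factor passes from the frame of the chart at
[x0] to that of the chart at [y]. *)
Definition nablaJ (j : 'I_3) (y : M) (v : 'cV[R]_m) : 'M[R]_m :=
  (\matrix_(r, l) (D y v (fun z => J j z *m chart_field x0 (delta_mx l 0) z)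
     - J j y *m D y v (chart_field x0 (delta_mx l 0))) r 0) *m jac y x0 y.

Lemma nablaJP j y v : U y ->
  Q y (nablaJ j y v) /\ endo_deriv D y v (J j) (nablaJ j y v).
Proof.
move=> Uy; have dy := Ux Uy; have dyy := chart_at_dom y.
have QJ z : U z -> Q z (J j z).
  by move=> Uz; rewrite -comb_delta; exact: adm_comb.
have [A QA dA] := hD.2 _ _ oU (adm_smooth aJ j) QJ y v Uy.
suff -> : nablaJ j y v = A by [].
rewrite /nablaJ -[RHS]mulmx1 -(jacK dy dyy) mulmxA; congr (_ *m _).
apply/matrixP => r l; rewrite mxE.
have sc := @chart_field_smooth R m M x0 (delta_mx l 0).
rewrite -(dA _ _ (@chart_dom_open _ _ _ x0) dy sc).
rewrite /chart_field mulmxA; exact: mulmx_delta.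
Qed.

Lemma nablaJ_linear j y a v w : U y ->
  nablaJ j y (a *: v + w) = a *: nablaJ j y v + nablaJ j y w.
Proof.
move=> Uy; rewrite /nablaJ scalemxAl -mulmxDl; congr (_ *m _).
apply/matrixP => r l; rewrite [LHS]mxE.
have sc := smooth_vfield_sub Ux (@chart_field_smooth R m M x0 (delta_mx l 0)).
rewrite (conn_linear lD oU sc) //.
rewrite (conn_linear lD oU (adm_smooth aJ j oU (@subset_refl _ _) sc)) //.
by rewrite mulmxDr -scalemxAr !mxE; ring.
Qed.

(** The connection form of the bundle [Q] in the frame [J]: the covariant derivative
of [\sum_i s_i J_i] along [v] has coefficients [ds(v) + conn_form y v (s y)]. *)
Definition conn_form (y : M) (v : 'cV[R]_m) (a : 'rV[R]_3) : 'rV[R]_3 :=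
  \sum_j a 0 j *: coef (Jy y) (nablaJ j y v).

Lemma combD y a b : comb J y (a + b) = comb J y a + comb J y b.
Proof. exact: (@quatD R m (Jy y)). Qed.

Lemma combZ y k a : comb J y (k *: a) = k *: comb J y a.
Proof. exact: (@quatZ R m (Jy y)). Qed.

Lemma comb_sum y (I : finType) (F : I -> 'rV[R]_3) :
  comb J y (\sum_i F i) = \sum_i comb J y (F i).
Proof.
suff h s : comb J y (\sum_(i <- s) F i) = \sum_(i <- s) comb J y (F i) by exact: h.
elim: s => [|i s IH]; last by rewrite !big_cons combD IH.
by rewrite !big_nil -(scale0r 0) combZ scale0r.
Qed.

Lemma conn_formE y v a : U y ->
  comb J y (conn_form y v a) = \sum_j a 0 j *: nablaJ j y v.
Proof.
move=> Uy; rewrite comb_sum; apply: eq_bigr => j _; rewrite combZ adm_combK //.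
by have [] := nablaJP j v Uy.
Qed.

Lemma conn_form_linear y k v w a : U y ->
  conn_form y (k *: v + w) a = k *: conn_form y v a + conn_form y w a.
Proof.
move=> Uy; rewrite /conn_form scaler_sumr -big_split; apply: eq_bigr => j _ /=.
rewrite nablaJ_linear // scalerA mulrC -scalerA -scalerDr; congr (_ *: _).
apply/rowP => i; rewrite !mxE mulmxDl -scalemxAl raddfD /= mxtraceZ.
by rewrite mulrDl opprD mulrN mulrA.
Qed.

Lemma endo_deriv_section V y v (s : M -> 'rV[R]_3) : open V -> V `<=` U ->
  V y -> (forall i, smooth_fun V (fun z => s z 0 i)) ->
  endo_deriv D y v (fun z => comb J z (s z))
    (comb J y ((\row_i tderiv y v (fun z => s z 0 i)) + conn_form y v (s y))).
Proof.
move=> oV VU Vy ss; have Uy := VU _ Vy.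
have := @endo_deriv_comb D lD V y v _ (fun i z => s z 0 i) J
  (fun i z => nablaJ i z v) oV Vy ss
  (fun i => smooth_endo_sub VU (adm_smooth aJ i))
  (fun i => (nablaJP i v Uy).2).
rewrite big_split /= combD conn_formE // => h; congr (endo_deriv _ _ _ _ _): h.
by congr (_ + _); apply: eq_bigr => i _; rewrite mxE.
Qed.

(** The square of [\sum_i a_i J_i] is the constant [- |a|^2], hence its covariant
derivative, whose coefficients are [conn_form y v a], anticommutes with it; and
the anticommutator of two combinations is [- 2] times the scalar product of their
coefficients. *)
Lemma dot_conn_form y v a : U y -> dot (conn_form y v a) a = 0.
Proof.
move=> Uy; have dy := Ux Uy.
have hs : endo_deriv D y v (fun z => comb J z a) (comb J y (conn_form y v a)).
  have := @endo_deriv_section U y v (fun _ => a) oU (@subset_refl _ U) Uy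
    (fun i => @smooth_fun_cst R m M U (a 0 i)).
  rewrite (_ : (\row_i _) = 0) ?add0r //.
  by apply/rowP => i; rewrite !mxE /tderiv; exact: (derive_cst (a 0 i)).
set A := comb J y (conn_form y v a) in hs.
have hA : A *m comb J y a + comb J y a *m A = 0.
  apply: mulmx_cv_inj => w; rewrite mul0mx.
  have -> : w = chart_field x0 (jac y x0 y *m w) y.
    by rewrite /chart_field mulmxA jacK ?mul1mx //; exact: chart_at_dom.
  set Y := chart_field x0 _.
  have sY : smooth_vfield U Y by exact: smooth_vfield_sub Ux (chart_field_smooth _).
  have sJY i : smooth_vfield U (fun z => J i z *m Y z).
    exact: (adm_smooth aJ i oU (@subset_refl _ _) sY).
  have sCY : smooth_vfield U (fun z => comb J z a *m Y z).
    have h := smooth_vfield_sum (fun i =>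
      smooth_vfield_scale (@smooth_fun_cst R m M U (a 0 i)) (sJY i)).
    apply: smooth_vfield_eq h => z _; rewrite mulmx_suml.
    by apply: eq_bigr => i _; rewrite scalemxAl.
  have e1 := hs _ _ oU Uy sY.
  have e2 := hs _ _ oU Uy sCY.
  have aa z : U z -> comb J z a *m (comb J z a *m Y z) = (- dot a a) *: Y z.
    move=> Uz; rewrite mulmxA adm_quat_mul // crossvv.
    by rewrite -(scale0r 0) combZ scale0r addr0 mulNmx mul_scalar_mx scaleNr.
  have e3 : D y v (fun z => comb J z a *m (comb J z a *m Y z))
      = (- dot a a) *: D y v Y.
    rewrite -(conn_scale lD v (- dot a a) oU sY Uy).
    have sa := smooth_vfield_scale (@smooth_fun_cst R m M U (- dot a a)) sY.
    exact: (conn_local lD oU (smooth_vfield_eq (fun z Uz => esym (aa z Uz)) sa)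
      sa aa v Uy).
  rewrite mulmxDl -!mulmxA e2 e1 e3 mulmxBr addrA subrK.
  rewrite mulmxA adm_quat_mul // crossvv.
  by rewrite -(scale0r 0) combZ scale0r addr0 mulNmx mul_scalar_mx scaleNr subrr.
move: hA; rewrite /A !adm_quat_mul // (dotC a).
have -> : cross a (conn_form y v a) = (-1) *: cross (conn_form y v a) a.
  by rewrite scaleN1r -crossC.
rewrite combZ scaleN1r.
rewrite addrACA subrr addr0 => /matrixP/(_ (Ordinal m0) (Ordinal m0)).
by rewrite !mxE eqxx !mulr1n => h; lra.
Qed.

(** The trace that computes [coef] can be taken in the frame of the chart at [x0],
where the entries of [nablaJ] are the components of smooth vector fields. *)
Lemma conn_form_smooth xi i j :
  smooth_fun U (fun y => coef (Jy y) (nablaJ j y (chart_field x0 xi y)) 0 i).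
Proof.
pose B l (y : M) := D y (chart_field x0 xi y) (fun z => J j z *m chart_field x0 (delta_mx l 0) z)
  + (-1) *: (J j y *m D y (chart_field x0 xi y) (chart_field x0 (delta_mx l 0))).
have sc l := smooth_vfield_sub Ux (@chart_field_smooth R m M x0 (delta_mx l 0)).
have sxi := smooth_vfield_sub Ux (@chart_field_smooth R m M x0 xi).
have sJ := adm_smooth aJ j oU (@subset_refl _ U).
have sB l : smooth_vfield U (B l).
  apply: smooth_vfield_add.
    exact: (conn_smooth lD oU sxi (sJ _ (sc l))).
  apply: smooth_vfield_scale; first exact: smooth_fun_cst.
  exact: (sJ _ (conn_smooth lD oU sxi (sc l))).
have sBc r l := smooth_vfield_comp r oU Ux (sB l).
have sE r l := endo_chart_smooth r l oU Ux (adm_smooth aJ i).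
have := smooth_fun_mul oU (@smooth_fun_cst R m M U (- m%:R^-1))
  (smooth_fun_sum oU (fun r => smooth_fun_sum oU (fun l =>
    smooth_fun_mul oU (sBc r l) (sE l r)))).
apply: smooth_fun_eq => // y Uy; have dy := Ux Uy; have dyy := chart_at_dom y.
rewrite mxE mulNr mulrC; congr (- (_ / _)).
set N := nablaJ j y _; pose P := jac y x0 y *m N *m jac x0 y y.
rewrite -(mxtrace_conj N (J i y) (jacK dy dyy)) -/P.
have PE r l : P r l = (jac y x0 y *m B l y) r 0.
  rewrite -[LHS]mulmx_delta.
  rewrite /P -(mulmxA (jac y x0 y *m N)) -(mulmxA (jac y x0 y)).
  congr ((_ *m _) r 0).
  have [_ dN] := nablaJP j (chart_field x0 xi y) Uy.
  rewrite /B scaleN1r; exact: (dN _ _ oU Uy (sc l)).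
rewrite /mxtrace; apply: eq_bigr => r _; rewrite mxE; apply: eq_bigr => l _.
by rewrite PE.
Qed.

End Quaternionic.

End Connection.

(** * Charts of the twistor space *)

Lemma normalize_smooth (R : realType) (V : normedModType R) S (a : V -> 'rV[R]_3) i :
  open S -> (forall q, S q -> a q != 0) -> (forall j, smooth_on S (fun q => a q 0 j)) ->
  smooth_on S (fun q => normalize (a q) 0 i).
Proof.
move=> oS S0 sa.
apply: (@smooth_on_eq _ _ _ _
  (fun q => (Num.sqrt (dot (a q) (a q)))^-1 * a q 0 i)) => //.
  by move=> q _; rewrite /normalize mxE.
have sd : smooth_on S (fun q => dot (a q) (a q)).
  by apply: smooth_on_sum => // j; exact: smooth_on_mul.
apply: smooth_on_mul => // k; apply: Ck_on_inv => //.
  by move=> q /S0 q0; rewrite gt_eqF // sqrtr_gt0 dot_gt0.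
exact: (Ck_on_sqrt oS (fun q Sq => dot_gt0 (S0 q Sq)) (sd k)).
Qed.

Section TwistorCharts.
Context {R : realType} {m : nat} {M : manifold R m}.
Hypothesis m0 : (0 < m)%N.
Variable Q : M -> set 'M[R]_m.
Local Notation ch := (@chart_at R m M).
Local Notation endo_pt := (M * 'M[R]_m)%type.
Local Notation E := ('cV[R]_m * 'rV[R]_3)%type.

Lemma sphere_ptE (J : 'I_3 -> M -> 'M[R]_m) y a :
  sphere_pt J y a = (y, comb J y (normalize a)).
Proof.
by [].
Qed.

Section AdmissibleBasis.
Variables (U : set M) (J : 'I_3 -> M -> 'M[R]_m).
Hypothesis aJ : admissible_basis Q U J.

Lemma twistor_comb y a : U y -> twistor Q (y, comb J y a) <-> dot a a = 1.
Proof.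
move=> Uy; have h : comb J y a *m comb J y a = - 1%:M <-> dot a a = 1.
  apply: (@quat_sq1 R m (fun i => J i y)) => //.
  - by move=> i; exact: (adm_sq aJ).
  - exact: (adm_12 aJ).
  - exact: (adm_21 aJ).
split=> [[_ /h]//|/h ?]; split => //=; exact: (adm_comb aJ).
Qed.

Lemma twistor_sphere y a : U y -> a != 0 -> twistor Q (sphere_pt J y a).
Proof.
by move=> Uy a0; rewrite sphere_ptE; apply/(twistor_comb _ Uy); exact: normalize_unit.
Qed.

Lemma twistor_coef p : U p.1 -> twistor Q p ->
  let a := coef (fun i => J i p.1) p.2 in
  dot a a = 1 /\ p = (p.1, comb J p.1 a).
Proof.
case: p => y A /= Uy tA; have [/= QA _] := tA.
have e := adm_combK m0 aJ Uy QA.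
by rewrite e; split=> //; apply/(twistor_comb _ Uy); rewrite e.
Qed.

(** The trace that computes [coef] can be taken in the frame of a chart. *)
Lemma coef_smooth x V A i : open V -> V `<=` U -> V `<=` cdom (ch x) ->
  smooth_endo V A -> smooth_fun V (fun y => coef (fun i => J i y) (A y) 0 i).
Proof.
move=> oV VU Vx sA.
have sJ := endo_chart_smooth _ _ oV Vx (smooth_endo_sub VU (adm_smooth aJ i)).
have sA' := endo_chart_smooth _ _ oV Vx sA.
have := smooth_fun_mul oV (@smooth_fun_cst R m M V (- m%:R^-1))
  (smooth_fun_sum oV (fun r => smooth_fun_sum oV (fun l =>
    smooth_fun_mul oV (sA' r l) (sJ l r)))).
apply: smooth_fun_eq => // y Vy; have dy := Vx _ Vy.
rewrite mxE mulNr mulrC; congr (- (_ / _)).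
rewrite -(mxtrace_conj (A y) (J i y) (jacK dy (chart_at_dom y))).
by rewrite /mxtrace; apply: eq_bigr => r _; rewrite [RHS]mxE.
Qed.

(** The part of R^m x (R^3 - 0) that parametrizes [O]; functions on the sphere are
viewed as functions of [a <> 0] that are homogeneous of degree 0. *)
Definition basis_dom x (O : set endo_pt) : set E :=
  [set q | [/\ cimg (ch x) q.1, U (cinv (ch x) q.1), q.2 != 0
     & O (sphere_pt J (cinv (ch x) q.1) q.2)]].

Lemma basis_dom_open x O : twistor_open Q O -> open (basis_dom x O).
Proof.
move=> [_ /(_ _ _ aJ)]; rewrite !openE => oO q [iq Uq q0 Oq].
have nq : nbhs (cinv (ch x) q.1, q.2) _ := oO (cinv (ch x) q.1, q.2) (And3 Uq q0 Oq).
have cq : (fun r : E => (cinv (ch x) r.1, r.2)) @ q --> (cinv (ch x) q.1, q.2).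
  have c1 : {for q, continuous (fun r : E => cinv (ch x) r.1)}.
    apply: (@continuous_comp _ _ _ fst (cinv (ch x)) q); first exact: cvg_fst.
    exact: (cinv_continuous (chart_atP x) iq).
  have c2 : {for q, continuous (fun r : E => r.2)} by exact: cvg_snd.
  exact: cvg_pair c1 c2.
have n1 := cq _ nq.
have n2 : nbhs q [set r : E | cimg (ch x) r.1].
  have n3 : nbhs q.1 (cimg (ch x)).
    by apply: open_nbhs_nbhs; split => //; exact: (cimg_open (chart_atP x)).
  have c1 : {for q, continuous (fst : E -> 'cV[R]_m)} by exact: cvg_fst.
  exact: c1 _ n3.
by apply: (filterS _ (filterI n2 n1)) => r [ir [Ur r0 Or]].
Qed.

End AdmissibleBasis.

Definition twistor_over (V : set M) : set endo_pt :=
  [set p | twistor Q p /\ V p.1].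

Lemma rv_neq0_open : open [set a : 'rV[R]_3 | a != 0].
Proof.
have : closed [set (0 : 'rV[R]_3)].
  exact/accessible_closed_set1/hausdorff_accessible/norm_hausdorff.
rewrite -openC; congr open.
by apply/seteqP; split=> a /= /eqP.
Qed.

Lemma twistor_over_open V : open V -> twistor_open Q (twistor_over V).
Proof.
move=> oV; split=> [p []//|U J aJ].
have -> : [set q : M * 'rV[R]_3 | [/\ U q.1, q.2 != 0
    & twistor_over V (sphere_pt J q.1 q.2)]]
  = (U `&` V) `*` [set a | a != 0].
  apply/seteqP; split=> -[y a] /=.
    by move=> [Uy a0 [_ Vy]].
  by move=> [[Uy Vy] a0]; split=> //; split=> //; exact: twistor_sphere aJ _ _ Uy a0.
rewrite openE => -[y a] /= [UVy a0].
exists (U `&` V, [set a | a != 0]) => //; split; apply: open_nbhs_nbhs; split => //.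
  by apply: openI => //; exact: adm_open aJ.
exact: rv_neq0_open.
Qed.

Lemma twistor_openI O O' : twistor_open Q O -> twistor_open Q O' ->
  twistor_open Q (O `&` O').
Proof.
move=> [OZ oO] [_ oO']; split=> [p [/OZ]//|U J aJ].
have := openI (oO U J aJ) (oO' U J aJ); congr open.
by apply/seteqP; split=> q /= => [[[? ? ?] [? ? ?]]|[? ? [? ?]]]; do !split.
Qed.

Lemma twistor_smooth_sub O O' f : O' `<=` O -> twistor_smooth Q O f ->
  twistor_smooth Q O' f.
Proof.
move=> OO sf U J aJ z; apply: smooth_on_sub (sf U J aJ z).
by move=> q [? ? ? /OO].
Qed.

Section Chart.
Variables (x0 : M) (U : set M) (J : 'I_3 -> M -> 'M[R]_m).
Hypotheses (aJ : admissible_basis Q U J) (Ux : U `<=` cdom (ch x0)).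

(** Positive multiples of [q.2] give the same point; [twistor_coord] selects the one
of norm 1. *)
Definition twistor_pt (q : E) : endo_pt := sphere_pt J (cinv (ch x0) q.1) q.2.

Definition twistor_coord (p : endo_pt) : E :=
  (cmap (ch x0) p.1, coef (fun i => J i p.1) p.2).

Definition coord_dom (O : set endo_pt) : set E := basis_dom U J x0 O.

Lemma twistor_coordK p : U p.1 -> twistor Q p ->
  dot (twistor_coord p).2 (twistor_coord p).2 = 1 /\ twistor_pt (twistor_coord p) = p.
Proof.
move=> Up tp; have [/= a1 pE] := twistor_coef aJ Up tp.
split => //; rewrite [RHS]pE /twistor_pt /= sphere_ptE normalize_id //.
by rewrite (cmapK (chart_atP x0) (Ux Up)).
Qed.

Lemma twistor_ptK q : cimg (ch x0) q.1 -> U (cinv (ch x0) q.1) ->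
  twistor_coord (twistor_pt q) = (q.1, normalize q.2).
Proof.
move=> iq Uq; rewrite /twistor_coord /twistor_pt sphere_ptE /= (cinvK iq).2.
by rewrite (adm_coefK m0 aJ).
Qed.

Lemma coord_dom_twistor_coord O p : U p.1 -> twistor Q p -> O p -> coord_dom O (twistor_coord p).
Proof.
move=> Up tp Op; have [a1 pE] := twistor_coordK Up tp.
split; [exact: cimg_cmap (Ux Up)| |exact: unit_neq0|
  by rewrite -[sphere_pt _ _ _]/(twistor_pt (twistor_coord p)) pE].
by rewrite /= (cmapK (chart_atP x0) (Ux Up)).
Qed.

Definition normalize_pair (q : E) : E := (q.1, normalize q.2).

Lemma twistor_pt_normalize q : q.2 != 0 -> twistor_pt (normalize_pair q) = twistor_pt q.
Proof.
by move=> q0; rewrite /twistor_pt !sphere_ptE /= (normalize_id (normalize_unit q0)).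
Qed.

Lemma coord_dom_normalize O q : coord_dom O q -> coord_dom O (normalize_pair q).
Proof.
move=> [iq Uq q0 Oq]; split => //=; first exact/unit_neq0/normalize_unit.
by rewrite -[sphere_pt _ _ _]/(twistor_pt (normalize_pair q)) twistor_pt_normalize.
Qed.

(** In another admissible basis [J'] one has [\sum_j a_j J'_j = \sum_i T(y)(a)_i J_i],
where [T(y)] is linear with coefficients that are smooth in [y].  Comparing the
squares of both sides shows that [T(y)] is an isometry, so it commutes with the
radial projection to the sphere, and the change of coordinates is
[(u, a) |-> (transition u, T a)]. *)
Lemma twistor_smooth_chart O f : twistor_open Q O -> O `<=` twistor_over U ->
  smooth_on (coord_dom O) (f \o twistor_pt) -> twistor_smooth Q O f.
Proof.
move=> oO OU sf U' J' aJ' z /=.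
have oS := basis_dom_open (x := z) aJ' oO; rewrite /basis_dom in oS.
set S := [set q : E | _] in oS *.
pose V := U `&` U'.
have oV : open V by apply: openI; [exact: adm_open aJ|exact: adm_open aJ'].
(* the matrix of the change of basis T *)
pose t i j (y : M) : R := coef (fun k => J k y) (J' j y) 0 i.
have st i j : smooth_fun V (t i j).
  apply: (coef_smooth (x := x0) aJ i oV); first exact: subIsetl.
    by move=> y [/Ux].
  by apply: smooth_endo_sub (adm_smooth aJ' j); exact: subIsetr.
pose T y (a : 'rV[R]_3) : 'rV[R]_3 := \row_i \sum_j t i j y * a 0 j.
have TE y a : V y -> comb J y (T y a) = comb J' y a.
  move=> [Uy U'y]; rewrite -[RHS](adm_combK m0 aJ Uy); last exact: adm_comb aJ' _ _ U'y.
  congr comb; apply/rowP => i; rewrite !mxE /comb mulmx_suml raddf_sum.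
  rewrite mulr_suml -sumrN; apply: eq_bigr => j _.
  by rewrite /t mxE -scalemxAl /= mxtraceZ; ring.
have dT y a : V y -> dot (T y a) (T y a) = dot a a.
  move=> Vy; have [Uy U'y] := Vy.
  have := adm_quat_mul aJ (T y a) (T y a) Uy.
  rewrite TE // (adm_quat_mul aJ' a a U'y).
  rewrite !crossvv -(scale0r 0) !combZ !scale0r !addr0 => /oppr_inj.
  by move=> /matrixP/(_ (Ordinal m0) (Ordinal m0)); rewrite !mxE eqxx !mulr1n.
have TZ y k a : T y (k *: a) = k *: T y a.
  apply/rowP => i; rewrite !mxE mulr_sumr; apply: eq_bigr => j _.
  by rewrite mxE; ring.
have Sin q : S q -> V (cinv (ch z) q.1).
  by move=> [iq U'q q0 /OU [_ Uq]].
have SE q : S q -> twistor_pt (transition z x0 q.1, T (cinv (ch z) q.1) q.2)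
    = sphere_pt J' (cinv (ch z) q.1) q.2.
  move=> Sq; have Vq := Sin q Sq; have [Uq _] := Vq.
  rewrite /twistor_pt /transition !sphere_ptE /= (cmapK (chart_atP x0) (Ux Uq)).
  congr (_, _); rewrite -TE // /normalize dT // TZ.
  by [].
apply: (@smooth_on_eq _ _ _ _ (fun q : E =>
    (f \o twistor_pt) (transition z x0 q.1, T (cinv (ch z) q.1) q.2))) => //.
  by move=> q Sq; rewrite /= SE.
apply: smooth_on_comp_pair sf => //.
- move=> q Sq; have [iq U'q q0 Oq] := Sq; have Vq := Sin q Sq; have [Uq _] := Vq.
  split => /=.
  + rewrite /transition /=; exact: cimg_cmap (Ux Uq).
  + by rewrite /transition /= (cmapK (chart_atP x0) (Ux Uq)).
  + apply: contraNneq q0 => T0; apply/eqP; apply: contra_eq (dT _ q.2 Vq) => /dot_gt0.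
    rewrite T0 => d0; rewrite (_ : dot 0 0 = 0) ?lt_eqF //.
    by rewrite dotE !mxE; ring.
  + by have := SE q Sq; rewrite /twistor_pt /= => ->.
- move=> i; apply: (smooth_on_fst (p := 3) oS (g := fun u => transition z x0 u i 0)).
  apply: smooth_on_sub (_ : smooth_on (chart_img z V) _).
    by move=> u [a Sq]; split; [have [] := Sq|exact: Sin _ Sq].
  apply: smooth_on_coord_cv; first exact: chart_img_open.
  by apply: smooth_on_sub (@transition_map_smooth _ _ _ z x0) => u [iu [/Ux]].
- move=> i; apply: (@smooth_on_eq _ _ _ _ (fun q : E =>
    \sum_j (t i j \o cinv (ch z)) q.1 * q.2 0 j)) => //.
    by move=> q _; rewrite mxE.
  apply: smooth_on_sum => // j; apply: smooth_on_mul => //; last exact: smooth_on_snd.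
  apply: (smooth_on_fst (p := 3) oS).
  apply: smooth_on_sub (st i j z) => u [a Sq].
  by split; [have [] := Sq|exact: Sin _ Sq].
Qed.

End Chart.

End TwistorCharts.

(** * Tangent vectors to the twistor space in a chart *)

Section TangentVectors.
Context {R : realType} {m : nat} {M : manifold R m}.
Hypothesis m0 : (0 < m)%N.
Variable Q : M -> set 'M[R]_m.
Local Notation ch := (@chart_at R m M).
Local Notation endo_pt := (M * 'M[R]_m)%type.
Local Notation E := ('cV[R]_m * 'rV[R]_3)%type.
Variables (x0 : M) (U : set M) (J : 'I_3 -> M -> 'M[R]_m).
Hypotheses (aJ : admissible_basis Q U J) (Ux : U `<=` cdom (ch x0)).
Local Notation tp := (twistor_pt x0 J).
Local Notation tc := (twistor_coord x0 J).
Local Notation td := (coord_dom x0 U J).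
Local Notation ZU := (twistor_over Q U).

Let oU : open U. Proof. exact: (adm_open aJ). Qed.

Lemma over_open : twistor_open Q ZU.
Proof. exact: twistor_over_open. Qed.

Lemma smooth_nearP p f : ZU p -> smooth_near Q p f ->
  exists O, [/\ twistor_open Q O, O p, O `<=` ZU & twistor_smooth Q O f].
Proof.
move=> op [ O [oO Op sf]]; exists (O `&` ZU); split => //.
- exact: twistor_openI oO over_open.
- exact: twistor_smooth_sub (@subIsetl _ _ _) sf.
Qed.

Lemma twistor_pt_smooth O f : twistor_smooth Q O f -> smooth_on (td O) (f \o tp).
Proof. by move=> sf; exact: (sf U J aJ x0). Qed.

Lemma coord_dom_over O p : ZU p -> O p -> td O (tc p).
Proof. by move=> [tw Up] Op; exact: (coord_dom_twistor_coord m0 aJ Ux Up tw Op). Qed.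

Lemma twistor_pt_diff p f : ZU p -> smooth_near Q p f ->
  differentiable (f \o tp) (tc p).
Proof.
move=> op /(smooth_nearP op) [ O [oO Op OU sf]].
exact: smooth_on_diff (twistor_pt_smooth sf) (coord_dom_over op Op).
Qed.

Lemma twistor_coord_over p : ZU p -> tp (tc p) = p.
Proof. by move=> [tw Up]; have [] := twistor_coordK m0 aJ Ux Up tw. Qed.

Lemma twistor_coord_unit p : ZU p -> dot (tc p).2 (tc p).2 = 1.
Proof. by move=> [tw Up]; have [] := twistor_coordK m0 aJ Ux Up tw. Qed.

Lemma normalize_pair_smooth O (H : E -> R) : twistor_open Q O ->
  smooth_on (td O) H -> smooth_on (td O) (H \o @normalize_pair R m).
Proof.
move=> oO sH; have oS := basis_dom_open (x := x0) aJ oO.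
apply: smooth_on_comp_pair sH => //.
- move=> q tq; exact: (coord_dom_normalize tq).
- move=> i; exact: smooth_on_fst_coord.
- move=> i; apply: normalize_smooth => // [q []//|j]; exact: smooth_on_snd.
Qed.

(** The hypothesis on [f] concerns unit vectors [a] only; composing [H] with the
radial projection produces the homogeneous function of [a <> 0] on which
smoothness is tested. *)
Lemma coord_fun_smooth O f (H : E -> R) : twistor_open Q O -> O `<=` ZU ->
  smooth_on (td O) H -> (forall p, O p -> f p = H (tc p)) ->
  twistor_smooth Q O f.
Proof.
move=> oO OU sH fH; apply: (twistor_smooth_chart m0 aJ Ux oO OU).
apply: smooth_on_eq (normalize_pair_smooth oO sH); first exact: (basis_dom_open (x := x0) aJ oO).
move=> q [iq Uq q0 Oq] /=; rewrite fH //.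
by rewrite (twistor_ptK m0 aJ iq Uq).
Qed.

(** To first order, the radial projection fixes the directions tangent to the sphere. *)
Lemma derive_normalize (q w : E) : dot q.2 q.2 = 1 -> dot w.2 q.2 = 0 ->
  differentiable (@normalize_pair R m) q /\ 'D_w (@normalize_pair R m) q = w.
Proof.
move=> q1 wq.
have d1 : differentiable (fst : E -> 'cV[R]_m) q.
  apply: differentiable_cv => i.
  exact: (smooth_on_diff (@smooth_on_fst_coord R m 3 setT i)).
have dc i : differentiable (fun r : E => r.2 0 i) q.
  exact: (smooth_on_diff (@smooth_on_snd R m 3 setT i)).
have ec i : 'D_w (fun r : E => r.2 0 i) q = w.2 0 i.
  exact: derive_snd_coord.
have d2 : differentiable (snd : E -> 'rV[R]_3) q by exact: differentiable_rv.
have dmul i : differentiable (fun r : E => r.2 0 i * r.2 0 i) q.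
  exact: differentiableM.
have [dd ed] := derive_sumf w dmul.
have {}ed : 'D_w (fun r : E => dot r.2 r.2) q = 0.
  transitivity (2 * dot w.2 q.2); last by rewrite wq mulr0.
  rewrite [LHS]ed /dot mulr_sumr; apply: eq_bigr => i _.
  by rewrite derive_mulf // ec; ring.
have q10 : 0 < dot q.2 q.2 by rewrite q1.
have [ds es] := sqrt_fun_diff w dd q10.
rewrite ed mul0r mulr0 in es.
have sq1 : Num.sqrt (dot q.2 q.2) = 1 by rewrite q1 sqrtr1.
have sq0 : Num.sqrt (dot q.2 q.2) != 0 by rewrite sq1 oner_neq0.
have [di ei] := inv_fun_diff w ds sq0.
rewrite es mul0r oppr0 in ei.
pose g (r : E) i := (Num.sqrt (dot r.2 r.2))^-1 * r.2 0 i.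
have nE i : (fun r : E => normalize r.2 0 i) = g^~ i.
  by apply/funext => r; rewrite /g mxE.
have dn i : differentiable (fun r : E => normalize r.2 0 i) q.
  by rewrite nE; apply: differentiableM.
have dnrm : differentiable (fun r : E => normalize r.2) q by exact: differentiable_rv.
split; first exact: differentiable_pair d1 dnrm.
rewrite (derive_pair w d1 dnrm) [RHS]surjective_pairing; congr (_, _).
  apply/matrixP => i j; rewrite ord1 (derive_entry w i 0 d1).
  exact: derive_fst_coord.
apply/rowP => i; rewrite (derive_entry w 0 i dnrm) nE /g derive_mulf //.
by rewrite ei mulr0 addr0 sq1 invr1 mul1r ec.
Qed.

(** In directions tangent to the sphere, [H] has the same derivative as its
homogeneous extension from the sphere. *)
Lemma coord_fun_derive O f (H : E -> R) p w : twistor_open Q O ->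
  O `<=` ZU -> smooth_on (td O) H -> (forall p, O p -> f p = H (tc p)) ->
  O p -> dot w.2 (tc p).2 = 0 ->
  'D_w (f \o tp) (tc p) = 'D_w H (tc p).
Proof.
move=> oO OU sH fH Op wp; have op := OU _ Op.
have tq := coord_dom_over op Op.
have a1 := twistor_coord_unit op.
have [dn en] := derive_normalize a1 wp.
have -> : 'D_w (f \o tp) (tc p) = 'D_w (H \o @normalize_pair R m) (tc p).
  apply: near_eq_derive.
  have : nbhs (tc p) (td O).
    by apply: open_nbhs_nbhs; split=> //; exact: (basis_dom_open (x := x0) aJ oO).
  apply: filterS => q [iq Uq q0 Oq] /=; rewrite fH //.
  by rewrite (twistor_ptK m0 aJ iq Uq).
have eq1 : normalize_pair (tc p) = tc p by rewrite /normalize_pair normalize_id.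
rewrite (derive_comp w dn) ?en eq1 //.
exact: smooth_on_diff sH tq.
Qed.

(** The tangent vector with coordinates [w]; [w] and [w'] give the same vector when
[w - w'] is radial. *)
Definition Tvec (p : endo_pt) (w : E) : (endo_pt -> R) -> R :=
  at_smooth Q p (fun f => 'D_w (f \o tp) (tc p)).

Lemma at_smoothE p v f : smooth_near Q p f -> at_smooth Q p v f = v f.
Proof. by rewrite /at_smooth; case: pselect. Qed.

Lemma at_smooth_eq p (v v' : (endo_pt -> R) -> R) :
  (forall f, smooth_near Q p f -> v f = v' f) -> at_smooth Q p v = at_smooth Q p v'.
Proof.
move=> h; apply/funext => f; rewrite /at_smooth; case: pselect => // sf.
exact: h.
Qed.

Lemma TvecD p w w' : ZU p -> Tvec p (w + w') = Tvec p w + Tvec p w'.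
Proof.
move=> op; apply/funext => f; transitivity (Tvec p w f + Tvec p w' f) => //.
rewrite /Tvec /at_smooth /=.
case: pselect => sf; last by rewrite addr0.
exact: derive_addl (twistor_pt_diff op sf).
Qed.

Lemma TvecZ p k w : ZU p -> Tvec p (k *: w) = fun f => k * Tvec p w f.
Proof.
move=> op; apply/funext => f; rewrite /Tvec /at_smooth /=.
case: pselect => sf; last by rewrite mulr0.
exact: derive_scalel (twistor_pt_diff op sf).
Qed.

Lemma TvecN p w : ZU p -> Tvec p (- w) = - Tvec p w.
Proof.
move=> op; rewrite -scaleN1r TvecZ //; apply/funext => f.
by rewrite mulN1r.
Qed.

Lemma Tvec_curve p (g : R -> endo_pt) (c : R -> E) : ZU p ->
  (\forall t \near (0 : R), g t = tp (c t)) -> c 0 = tc p ->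
  differentiable c 0 -> velocity Q p g = Tvec p ('D_1 c 0).
Proof.
move=> op gc c0 dc; apply: at_smooth_eq => f sf.
rewrite derive1E.
have -> : 'D_1 (f \o g) 0 = 'D_1 ((f \o tp) \o c) 0.
  by apply: near_eq_derive; apply: filterS gc => t /= ->.
rewrite (derive_comp (1 : R) dc) ?c0 //; exact: twistor_pt_diff.
Qed.

Lemma line_diff (q w : E) : differentiable (fun t : R => q + t *: w) 0 /\
  'D_1 (fun t : R => q + t *: w) 0 = w.
Proof.
have [dl el] := is_diff_line q w 0.
by split=> //; rewrite (deriveE _ dl) el scale1r.
Qed.

Lemma line_curve p w : ZU p ->
  curve_at Q p (fun t : R => tp (tc p + t *: w)) /\
  velocity Q p (fun t : R => tp (tc p + t *: w)) = Tvec p w.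
Proof.
move=> op; have [dl el] := line_diff (tc p) w.
have l0 : tc p + (0 : R) *: w = tc p by rewrite scale0r addr0.
split.
  split; first by rewrite l0 twistor_coord_over.
    have nO : nbhs (tc p + (0 : R) *: w) (td ZU).
      rewrite l0; apply: open_nbhs_nbhs; split; last exact: coord_dom_over.
      exact: (basis_dom_open (x := x0) aJ over_open).
    have n0 : \forall t \near (0 : R), td ZU (tc p + t *: w).
      exact: (differentiable_continuous dl nO).
    by apply: filterS n0 => t [? ? ? []].
  move=> f sf; apply: diff_derivable.
  apply: (differentiable_comp (g := f \o tp) dl); rewrite l0.
  exact: twistor_pt_diff.
rewrite (Tvec_curve op (c := fun t : R => tc p + t *: w)) ?el //.
exact: filterE.
Qed.

Lemma Tvec_tangent p w : ZU p -> tangent Q p (Tvec p w).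
Proof. by move=> /(line_curve w) [cw vw]; exists (fun t : R => tp (tc p + t *: w)). Qed.

Lemma Tvec_coord O f (H : E -> R) p w : twistor_open Q O ->
  O `<=` ZU -> smooth_on (td O) H -> (forall p, O p -> f p = H (tc p)) ->
  O p -> dot w.2 (tc p).2 = 0 -> Tvec p w f = 'D_w H (tc p).
Proof.
move=> oO OU sH fH Op wp; rewrite /Tvec at_smoothE.
  exact: coord_fun_derive oO OU sH fH Op wp.
by exists O; split=> //; exact: coord_fun_smooth oO OU sH fH.
Qed.

(** Functions on the sphere are extended by homogeneity of degree 0. *)
Lemma Tvec_radial p : ZU p -> Tvec p (0, (tc p).2) = 0.
Proof.
move=> op; apply/funext => f; rewrite /Tvec /at_smooth; case: pselect => // sf.
set w : E := (0, _).
rewrite /derive (_ : (fun h => _) = fun h =>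
  h^-1 *: ((f \o tp) (h *: w + tc p) - (f \o tp) (tc p))) //.
have [dl el] := line_diff (tc p) w.
have l0 : tc p + (0 : R) *: w = tc p by rewrite scale0r addr0.
have df : differentiable (f \o tp) (tc p + (0 : R) *: w).
  by rewrite l0; exact: twistor_pt_diff.
rewrite -[LHS]/('D_w (f \o tp) (tc p)) -{1}el -{1}l0 -(derive_comp (1 : R) dl df).
have -> : 'D_1 ((f \o tp) \o (fun t : R => tc p + t *: w)) 0
        = 'D_1 (fun _ : R => f p) 0.
  apply: near_eq_derive.
  have n0 : nbhs (0 : R) [set t : R | `|t| < 1].
    by apply/nbhs_ballP; exists 1 => //= t; rewrite -ball_normE /= sub0r normrN.
  apply: filterS n0 => t t1 /=; rewrite -[in RHS](twistor_coord_over op); congr f.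
  have t0 : 0 < 1 + t by move: t1; rewrite /= ltr_norml => /andP[]; lra.
  rewrite /twistor_pt !sphere_ptE /= scaler0 addr0; congr (_, comb _ _ _).
  have -> : (tc p).2 + t *: (tc p).2 = (1 + t) *: (tc p).2.
    by rewrite scalerDl scale1r.
  rewrite /normalize dotZl dotC dotZl !scalerA (twistor_coord_unit op) mulr1 -expr2 sqrtr_sqr.
  by rewrite gtr0_norm // mulVf ?gt_eqF // sqrtr1 invr1.
exact: (derive_cst (f p)).
Qed.

Lemma Tvec_base p w i : ZU p ->
  Tvec p w (fun r => cmap (ch x0) r.1 i 0) = w.1 i 0.
Proof.
move=> op; pose a := (tc p).2.
have wE : w = (w.1, w.2 - dot w.2 a *: a) + dot w.2 a *: (0, a).
  rewrite [LHS]surjective_pairing; congr (_, _).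
    by rewrite /= scaler0 addr0.
  by rewrite /= subrK.
rewrite {1}wE TvecD // TvecZ // Tvec_radial //.
set T := Tvec p _; set f := (X in (T + _) X).
have -> : (T + (fun f => dot w.2 a * (0 : (endo_pt -> R) -> R) f)) f = T f.
  by transitivity (T f + dot w.2 a * 0); rewrite ?mulr0 ?addr0.
rewrite /T.
rewrite (Tvec_coord (O := ZU) (H := fun q : E => q.1 i 0)) //.
- exact: derive_fst_coord.
- exact: over_open.
- exact: smooth_on_fst_coord.
- by rewrite /= dotDl dotNl dotZl (twistor_coord_unit op) mulr1 subrr.
Qed.

Lemma Tvec_fibre p w i : ZU p -> dot w.2 (tc p).2 = 0 ->
  Tvec p w (fun r => (tc r).2 0 i) = w.2 0 i.
Proof.
move=> op wp; rewrite (Tvec_coord (O := ZU) (H := fun q : E => q.2 0 i)) //.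
- exact: derive_snd_coord.
- exact: over_open.
- exact: smooth_on_snd.
Qed.

(** The coordinate functions of the base and of the fibre separate the vectors. *)
Lemma Tvec_inj p w w' : ZU p -> dot w.2 (tc p).2 = 0 ->
  dot w'.2 (tc p).2 = 0 -> Tvec p w = Tvec p w' -> w = w'.
Proof.
move=> op wp wp' e; rewrite [LHS]surjective_pairing [RHS]surjective_pairing.
congr (_, _).
  apply/matrixP => i j; rewrite ord1.
  by rewrite -(Tvec_base w i op) e Tvec_base.
by apply/rowP => i; rewrite -(Tvec_fibre i op wp) e Tvec_fibre.
Qed.

End TangentVectors.

(** * The almost complex structure in a chart *)

Section Tderiv.
Context {R : realType} {m : nat} {M : manifold R m}.
Local Notation ch := (@chart_at R m M).

Lemma tderiv_eq (V : set M) y v (f g : M -> R) : open V -> V y ->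
  (forall z, V z -> f z = g z) -> tderiv y v f = tderiv y v g.
Proof.
move=> oV Vy fg; apply: near_eq_derive.
by have := nbhs_cmap oV (chart_at_dom y) Vy; apply: filterS => u [_ /fg].
Qed.

(** Chain rule for a function of the position and of the coefficients of a section
of [Q]. *)
Lemma tderiv_pair x V y v (s : M -> 'rV[R]_3) (H : 'cV[R]_m * 'rV[R]_3 -> R) :
  open V -> V y -> V `<=` cdom (ch x) ->
  (forall i, smooth_fun V (fun z => s z 0 i)) ->
  differentiable H (cmap (ch x) y, s y) ->
  tderiv y v (fun z => H (cmap (ch x) z, s z))
    = 'D_(jac y x y *m v, \row_i tderiv y v (fun z => s z 0 i)) H
        (cmap (ch x) y, s y).
Proof.
move=> oV Vy Vx ss dH; rewrite /tderiv.
have dyy := chart_at_dom y; have dy := Vx _ Vy.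
set u := cmap (ch y) y.
have d1 : differentiable (transition y x) u by exact: transition_diff.
have e2 : cinv (ch y) u = y by rewrite (cmapK (chart_atP y)).
have ds i : differentiable (fun r => s (cinv (ch y) r) 0 i) u.
  exact: (smooth_fun_diff (ss i) dyy Vy).
have d2 : differentiable (fun r => s (cinv (ch y) r)) u by exact: differentiable_rv.
have dp := differentiable_pair d1 d2.
rewrite -[X in 'D_v X u]/(H \o (fun r => (transition y x r, s (cinv (ch y) r)))).
have e1 : transition y x u = cmap (ch x) y by rewrite transitionE.
have dH' : differentiable H (transition y x u, s (cinv (ch y) u)) by rewrite e1 e2.
rewrite (derive_comp v dp dH') (derive_pair v d1 d2) e1 e2 (jacE v dyy dy).
congr ('D_(_, _) H _).
by apply/rowP => i; rewrite (derive_entry v 0 i d2) mxE.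
Qed.

Lemma tderiv_affine y v (b c : R) (f : M -> R) :
  differentiable (f \o cinv (ch y)) (cmap (ch y) y) ->
  tderiv y v (fun z => b + f z * c) = tderiv y v f * c.
Proof.
move=> df; set u := cmap (ch y) y in df *.
have db : differentiable (fun _ : 'cV[R]_m => b) u := differentiable_cst b u.
have dc : differentiable (fun _ : 'cV[R]_m => c) u := differentiable_cst c u.
have dm : differentiable (fun r => (f \o cinv (ch y)) r * c) u.
  exact: differentiableM df dc.
have := deriveD (diff_derivable (v := v) db) (diff_derivable (v := v) dm).
rewrite (derive_cst b) add0r (derive_mulf v df dc) (derive_cst c) mulr0 add0r.
by rewrite mulrC.
Qed.

Lemma endo_deriv_eq (D : M -> 'cV[R]_m -> (M -> 'cV[R]_m) -> 'cV[R]_m) V y v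
    (s t : M -> 'M[R]_m) A : linear_connection D -> open V -> V y ->
  smooth_endo V s -> (forall z, V z -> s z = t z) ->
  endo_deriv D y v s A -> endo_deriv D y v t A.
Proof.
move=> lD oV Vy ss st h W Y oW Wy sY; rewrite (h _ _ oW Wy sY) (st _ Vy).
have oVW := openI oV oW.
have sY' : smooth_vfield (V `&` W) Y by apply: smooth_vfield_sub sY => z [].
have ssY := ss _ _ oVW (@subIsetl _ _ _) sY'.
have stY : smooth_vfield (V `&` W) (fun z => t z *m Y z).
  by apply: smooth_vfield_eq ssY => z [Vz _]; rewrite st.
have e z : (V `&` W) z -> s z *m Y z = t z *m Y z by case=> Vz _; rewrite st.
by rewrite (conn_local lD oVW ssY stY e v (conj Vy Wy)).
Qed.

End Tderiv.

Section Lifts.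
Context {R : realType} {m : nat} {M : manifold R m}.
Hypothesis m0 : (0 < m)%N.
Variables (Q : M -> set 'M[R]_m).
Variable D : M -> 'cV[R]_m -> (M -> 'cV[R]_m) -> 'cV[R]_m.
Hypothesis hD : quaternionic_connection Q D.
Local Notation ch := (@chart_at R m M).
Local Notation endo_pt := (M * 'M[R]_m)%type.
Local Notation E := ('cV[R]_m * 'rV[R]_3)%type.
Variables (x0 : M) (U : set M) (J : 'I_3 -> M -> 'M[R]_m).
Hypotheses (aJ : admissible_basis Q U J) (Ux : U `<=` cdom (ch x0)).
Local Notation tp := (twistor_pt x0 J).
Local Notation tc := (twistor_coord x0 J).
Local Notation td := (coord_dom x0 U J).
Local Notation ZU := (twistor_over Q U).
Local Notation TV := (Tvec Q x0 J).
Local Notation Gam := (conn_form D x0 J).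

Let oU : open U. Proof. exact: (adm_open aJ). Qed.

Lemma comb_twistor_coord p : ZU p -> comb J p.1 (tc p).2 = p.2.
Proof.
move=> [tw Up]; have [_ pE] := twistor_coef m0 aJ Up tw.
exact: (esym (congr1 snd pE)).
Qed.

Lemma comb0 y : comb J y 0 = 0.
Proof. by rewrite -(scale0r 0) combZ scale0r. Qed.

Lemma comb_inj y a b : U y -> comb J y a = comb J y b -> a = b.
Proof.
by move=> Uy e; rewrite -[a](adm_coefK m0 aJ _ Uy) e (adm_coefK m0 aJ).
Qed.

(** The anticommutator of [\sum_i b_i J_i] and [\sum_i a_i J_i] is [- 2 <b, a>]. *)
Lemma verticalP p W : ZU p ->
  vertical Q p W <-> exists2 b, dot b (tc p).2 = 0 & W = comb J p.1 b.
Proof.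
move=> zp; have [_ Up] := zp; set a := (tc p).2.
(* the anticommutator, for arbitrary b *)
have key b : comb J p.1 b *m p.2 + p.2 *m comb J p.1 b = (- (2 * dot b a))%:M.
  rewrite -(comb_twistor_coord zp) -/a !(adm_quat_mul aJ) // (dotC a) addrACA -combD.
  rewrite (crossC a) subrr comb0 addr0 -[LHS]opprK opprD !opprK.
  by rewrite -raddfD -raddfN; congr (_ %:M); ring.
split=> [[QW h]|[b ba ->]].
  exists (coef (fun i => J i p.1) W); last by rewrite (adm_combK m0 aJ).
  have := key (coef (fun i => J i p.1) W); rewrite (adm_combK m0 aJ) // h.
  move=> /matrixP/(_ (Ordinal m0) (Ordinal m0)); rewrite !mxE eqxx mulr1n => e.
  by lra.
split; first exact: (adm_comb aJ).
by rewrite key ba mulr0 oppr0 raddf0.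
Qed.

Lemma mul_vertical p b : ZU p -> dot b (tc p).2 = 0 ->
  p.2 *m comb J p.1 b = comb J p.1 (cross (tc p).2 b).
Proof.
move=> zp ba; have [_ Up] := zp; rewrite -{1}(comb_twistor_coord zp) (adm_quat_mul aJ) //.
by rewrite dotC ba raddf0 oppr0 add0r.
Qed.

Lemma coef_curve (K : 'I_3 -> 'M[R]_m) (B : R -> 'M[R]_m) W :
  is_derive (0 : R) (1 : R) B W ->
  differentiable (fun t => coef K (B t)) 0 /\
  'D_1 (fun t => coef K (B t)) 0 = coef K W.
Proof.
move=> [dB eB]; have dB' : differentiable B 0 by apply/derivable1_diffP.
have coefE A i : coef K A 0 i
    = \sum_r (\sum_l A r l * (- (K i l r / m%:R))).
  rewrite mxE /mxtrace mulr_suml -sumrN; apply: eq_bigr => r _.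
  rewrite mxE mulr_suml -sumrN; apply: eq_bigr => l _; ring.
have dBE r l : differentiable (fun t => B t r l) 0.
  exact: (differentiable_comp dB' (differentiable_coord _ r l)).
have dt i r l : differentiable (fun t => B t r l * (- (K i l r / m%:R))) 0.
  by apply: differentiableM => //; exact: (differentiable_cst (- (K i l r / m%:R))).
have et i r l : 'D_1 (fun t => B t r l * (- (K i l r / m%:R))) 0
    = W r l * (- (K i l r / m%:R)).
  set k := - _; have dk : differentiable (fun _ : R => k) 0 := differentiable_cst k 0.
  rewrite (derive_mulf (1 : R) (dBE r l) dk) (derive_cst k) mulr0 add0r mulrC.
  by rewrite -(derive_entry (1 : R) r l dB') eB.
have ds i r := derive_sumf (1 : R) (dt i r).
have dss i := derive_sumf (1 : R) (fun r => (ds i r).1).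
have fE i : (fun t => coef K (B t) 0 i)
    = fun t => \sum_r (\sum_l B t r l * (- (K i l r / m%:R))).
  by apply/funext => t; exact: coefE.
have dc : differentiable (fun t => coef K (B t)) 0.
  by apply: differentiable_rv => i; rewrite fE; exact: (dss i).1.
split=> //; apply/rowP => i; rewrite (derive_entry (1 : R) 0 i dc) fE (dss i).2 coefE.
by apply: eq_bigr => r _; rewrite (ds i r).2; apply: eq_bigr => l _; rewrite et.
Qed.

Lemma is_vertical_Tvec p b w : ZU p -> is_vertical Q p (comb J p.1 b) w ->
  w = TV p (0, b).
Proof.
move=> zp [B [cB dB ->]]; have [_ Up] := zp; have [B0 Btw _] := cB.
have [dc ec] := coef_curve (fun i => J i p.1) dB.
pose c (t : R) : E := (cmap (ch x0) p.1, coef (fun i => J i p.1) (B t)).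
have dcst := differentiable_cst (cmap (ch x0) p.1) (0 : R).
have dC : differentiable c 0 by exact: (differentiable_pair dcst dc).
have hc : \forall t \near (0 : R), (p.1, B t) = tp (c t).
  apply: filterS Btw => t tw.
  have [/= a1 e] := twistor_coef m0 aJ (p := (p.1, B t)) Up tw.
  rewrite [LHS]e /c /twistor_pt sphere_ptE /= normalize_id //.
  by rewrite (cmapK (chart_atP x0) (Ux Up)).
have c0 : c 0 = tc p by rewrite /c /twistor_coord (congr1 snd B0 : B 0 = p.2).
rewrite (Tvec_curve m0 aJ Ux zp hc c0 dC) (derive_pair (1 : R) dcst dc) ec.
by rewrite (derive_cst (cmap (ch x0) p.1)) (adm_coefK m0 aJ).
Qed.

(** The curve is the radial projection of the line [a + t b]. *)
Lemma Tvec_is_vertical p b : ZU p -> dot b (tc p).2 = 0 ->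
  is_vertical Q p (comb J p.1 b) (TV p (0, b)).
Proof.
move=> zp ba; have [_ Up] := zp; pose w : E := (0, b).
have [cw vw] := line_curve m0 aJ Ux w zp.
have gE : (fun t : R => tp (tc p + t *: w))
    = (fun t : R => (p.1, comb J p.1 (normalize ((tc p).2 + t *: b)))).
  apply/funext => t; rewrite /twistor_pt sphere_ptE /= scaler0 addr0.
  by rewrite (cmapK (chart_atP x0) (Ux Up)).
rewrite gE in cw vw.
exists (fun t => comb J p.1 (normalize ((tc p).2 + t *: b))).
split; [exact: cw| |exact: (esym vw)].
have [dl el] := line_diff (tc p) w.
have l0 : tc p + (0 : R) *: w = tc p by rewrite scale0r addr0.
have [dn en] := @derive_normalize _ _ (tc p) w (twistor_coord_unit m0 aJ Ux zp) ba.
have dn' : differentiable (@normalize_pair R m) (tc p + (0 : R) *: w) by rewrite l0.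
have dnl := differentiable_comp dl dn'.
have enl := derive_comp (1 : R) dl dn'; rewrite el l0 en in enl.
pose g i (t : R) := normalize ((tc p).2 + t *: b) 0 i.
have dsc i (q : E) : differentiable (fun r : E => r.2 0 i) q.
  exact: (smooth_on_diff (@smooth_on_snd R m 3 setT i)).
have dg i : differentiable (g i) 0 := differentiable_comp dnl (dsc i _).
have eg i : 'D_1 (g i) 0 = b 0 i.
  by rewrite [LHS](derive_comp (1 : R) dnl (dsc i _)) enl derive_snd_coord.
have dgJ i : differentiable (fun t => g i t *: J i p.1) 0.
  exact: differentiableZl.
have [ds es] := derive_sumf (1 : R) dgJ.
apply: DeriveDef; first exact: (diff_derivable ds).
rewrite [LHS]es; apply: eq_bigr => i _; rewrite (deriveE _ (dgJ i)).
by rewrite diffZl //= -(deriveE _ (dg i)) eg.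
Qed.

Lemma smooth_endo_comb V (s : M -> 'rV[R]_3) : open V -> V `<=` U ->
  (forall i, smooth_fun V (fun z => s z 0 i)) ->
  smooth_endo V (fun z => comb J z (s z)).
Proof.
move=> oV VU ss W Y oW WV sY.
have sJY i := adm_smooth aJ i oW (subset_trans WV VU) sY.
have ssW i := smooth_fun_sub WV (ss i).
have := smooth_vfield_sum (fun i => smooth_vfield_scale (ssW i) (sJY i)).
apply: smooth_vfield_eq => z _; rewrite mulmx_suml.
by apply: eq_bigr => i _; rewrite scalemxAl.
Qed.

(** If a section with coefficients [s] is parallel at [y] in the direction [Y], then
[ds(Y) = - conn_form y Y a]; the chain rule gives its derivative along [Y]. *)
Lemma is_hlift_Tvec p Y h : ZU p -> is_hlift Q D p Y h ->
  h = TV p (jac p.1 x0 p.1 *m Y, - Gam p.1 Y (tc p).2).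
Proof.
move=> zp [U1 [s [[oU1 U1y ss] [tws sy ds ->]]]]; have [tw Up] := zp.
have lD : linear_connection D by case: hD.
set y := p.1 in sy ds U1y Up *.
pose V := U1 `&` U; have oV : open V by exact: openI.
have Vy : V y by [].
have VU : V `<=` U by move=> z [].
have Vx : V `<=` cdom (ch x0) by move=> z /VU/Ux.
pose a z := coef (fun i => J i z) (s z).
have ssV : smooth_endo V s by apply: smooth_endo_sub ss => z [].
have sa i : smooth_fun V (fun z => a z 0 i) by exact: (coef_smooth aJ i oV VU Vx ssV).
have twc z : V z -> dot (a z) (a z) = 1 /\ comb J z (a z) = s z.
  move=> [U1z Uz]; have [/= a1 e] := twistor_coef m0 aJ (p := (z, s z)) Uz (tws _ U1z).
  by split=> //; case: e => <-.
have ay : a y = (tc p).2 by rewrite /a sy.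
have dsec := endo_deriv_section m0 hD aJ Ux Y oV VU Vy sa.
have ds' : endo_deriv D y Y (fun z => comb J z (a z)) 0.
  by apply: (endo_deriv_eq lD oV Vy ssV _ ds) => z /twc[].
have := endo_deriv_uniq (Ux Up) dsec ds'; rewrite -(comb0 y) => /(comb_inj Up).
move=> /eqP; rewrite addr_eq0 ay => /eqP da.
apply: at_smooth_eq => f sf.
have df := twistor_pt_diff m0 aJ Ux zp sf.
have fE z : V z -> f (z, s z) = (f \o tp) (cmap (ch x0) z, a z).
  move=> Vz; have [a1 e] := twc z Vz; rewrite /= /twistor_pt sphere_ptE /= normalize_id //.
  by rewrite (cmapK (chart_atP x0) (Vx _ Vz)) e.
rewrite (tderiv_eq _ oV Vy fE) (tderiv_pair _ oV Vy Vx sa).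
  by rewrite da ay.
by rewrite ay.
Qed.

(** The section has coefficients [a - g th], projected to the sphere, where
[th = conn_form y Y a] and [g] is an affine function of one coordinate with
[g y = 0] and [dg(Y) = 1].  As [th] is orthogonal to [a], the vector [a - g th]
never vanishes, and the projection does not change its derivative [- th]. *)
Lemma Tvec_is_hlift p Y : ZU p ->
  is_hlift Q D p Y (TV p (jac p.1 x0 p.1 *m Y, - Gam p.1 Y (tc p).2)).
Proof.
move=> zp; have [tw Up] := zp; have dy := Ux Up.
set y := p.1 in Up dy *; set a := (tc p).2; set th := Gam y Y a.
set xi := jac y x0 y *m Y.
(* g is k times the increment of the coordinate i0; if xi = 0 then th = 0. *)
have [k [i0 kE]] : exists k : R, exists i0 : 'I_m, (k * xi i0 0) *: th = th.
  have [x00|xn0] := eqVneq xi 0.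
    exists 0, (Ordinal m0); rewrite mul0r scale0r.
    have Y0 : Y = 0.
      have := congr1 (mulmx (jac x0 y y)) x00.
      by rewrite /xi mulmxA jacK ?mul1mx ?mulmx0 //; exact: chart_at_dom.
    have := conn_form_linear hD aJ Ux (-1) 0 0 a Up.
    by rewrite scaler0 addr0 scaleN1r addNr /th Y0.
  have /cV0Pn[i0 xi0] : xi != 0 by [].
  by exists (xi i0 0)^-1, i0; rewrite mulVf // scale1r.
pose g z := k * (cmap (ch x0) z i0 0 - cmap (ch x0) y i0 0).
have sg : smooth_fun (cdom (ch x0)) g.
  have oc := @chart_dom_open _ _ _ x0.
  apply: (smooth_fun_mul oc (@smooth_fun_cst _ _ _ _ k)).
  exact: (smooth_fun_add oc (@smooth_chart_coord _ _ _ x0 i0) (@smooth_fun_cst _ _ _ _ _)).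
pose s z : 'rV[R]_3 := a - g z *: th.
have ssx i : smooth_fun (cdom (ch x0)) (fun z => s z 0 i).
  have oc := @chart_dom_open _ _ _ x0.
  have := smooth_fun_add oc (@smooth_fun_cst _ _ _ _ (a 0 i))
    (smooth_fun_mul oc sg (@smooth_fun_cst _ _ _ _ (- th 0 i))).
  by apply: smooth_fun_eq => // z _; rewrite !mxE mulrN.
have sy : s y = a by rewrite /s /g subrr mulr0 scale0r subr0.
have a1 : dot a a = 1 := twistor_coord_unit m0 aJ Ux zp.
have tha : dot th a = 0 := dot_conn_form m0 hD aJ Ux Y a Up.
have s0 z : s z != 0.
  apply/negP => /eqP sz0; have : dot (s z) a = 1.
    by rewrite /s dotDl dotNl dotZl tha a1 mulr0 subr0.
  by rewrite sz0 dotE !mxE !mul0r !addr0 => /eqP; rewrite eq_sym oner_eq0.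
have ss i := smooth_fun_sub Ux (ssx i).
have sn i : smooth_fun U (fun z => normalize (s z) 0 i).
  move=> z; apply: (@normalize_smooth _ _ _ (fun u => s (cinv (ch z) u))).
  - exact: chart_img_open.
  - by move=> u _; exact: s0.
  - by move=> j; exact: ss.
have dsi i : tderiv y Y (fun z => s z 0 i) = - th 0 i.
  have -> : (fun z => s z 0 i) = (fun z =>
     (a 0 i + k * cmap (ch x0) y i0 0 * th 0 i)
      + cmap (ch x0) z i0 0 * (- (k * th 0 i))).
    by apply/funext => z; rewrite !mxE /g; ring.
  rewrite tderiv_affine; last first.
    exact: (smooth_fun_diff (@smooth_chart_coord _ _ _ x0 i0) (chart_at_dom y) dy).
  rewrite tderiv_chart_coord // -/xi; have /rowP/(_ i) := kE; rewrite mxE => e.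
  by rewrite -[in RHS]e; ring.
have dsE : (\row_i tderiv y Y (fun z => s z 0 i)) = - th.
  by apply/rowP => i; rewrite mxE dsi mxE.
pose w : E := (xi, - th).
have wa : dot w.2 (tc p).2 = 0 by rewrite dotNl tha oppr0.
have [dn en] := derive_normalize a1 wa.
have dni i : tderiv y Y (fun z => normalize (s z) 0 i) = - th 0 i.
  pose H (q : E) := (normalize_pair q).2 0 i.
  have dsc (q : E) : differentiable (fun r : E => r.2 0 i) q.
    exact: (smooth_on_diff (@smooth_on_snd R m 3 setT i)).
  have yE : (cmap (ch x0) y, s y) = tc p by rewrite sy.
  have dH : differentiable H (cmap (ch x0) y, s y).
    by rewrite yE; exact: (differentiable_comp dn (dsc _)).
  rewrite [LHS](tderiv_pair Y oU Up Ux ss dH) dsE yE.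
  rewrite [LHS](derive_comp w dn (dsc _)) en derive_snd_coord.
  by rewrite mxE.
have hl : is_hlift Q D p Y (at_smooth Q p (fun f =>
    tderiv y Y (fun z => f (z, comb J z (normalize (s z)))))).
  exists U, (fun z => comb J z (normalize (s z))); split; split => //.
  - exact: (smooth_endo_comb oU (@subset_refl _ U) sn).
  - by move=> z Uz; apply/(twistor_comb m0 aJ _ Uz); exact: normalize_unit.
  - by rewrite -/y sy normalize_id // comb_twistor_coord.
  - have := endo_deriv_section m0 hD aJ Ux Y oU (@subset_refl _ U) Up sn.
    have -> : \row_i tderiv y Y (fun z => normalize (s z) 0 i) = - th.
      by apply/rowP => i; rewrite mxE dni mxE.
    by rewrite sy normalize_id // addNr comb0.
by rewrite -(is_hlift_Tvec zp hl).
Qed.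

(** The complex structure [p.2] of the tangent space, in the frame of the chart at
[x0]. *)
Definition J_coord (p : endo_pt) (xi : 'cV[R]_m) : 'cV[R]_m :=
  jac p.1 x0 p.1 *m (p.2 *m (jac x0 p.1 p.1 *m xi)).

(** The decomposition of [(xi, eta)] into vertical and horizontal parts is
[(0, eta + Gam xi a) + (xi, - Gam xi a)]; the two parts are sent to
[(0, a x (eta + Gam xi a))] and [(J xi, - Gam (J xi) a)]. *)
Definition I1_coord (p : endo_pt) (w : E) : E :=
  (J_coord p w.1,
   cross (tc p).2 (w.2 + Gam p.1 (jac x0 p.1 p.1 *m w.1) (tc p).2)
   - Gam p.1 (p.2 *m (jac x0 p.1 p.1 *m w.1)) (tc p).2).

Lemma pairD (a a' : 'cV[R]_m) (b b' : 'rV[R]_3) :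
  ((a, b) : E) + (a', b') = (a + a', b + b').
Proof. by []. Qed.

Lemma Tvec_split p xi b c : ZU p ->
  TV p (0, b) + TV p (xi, c) = TV p (xi, b + c).
Proof.
move=> zp; have := TvecD m0 aJ Ux (0, b) (xi, c) zp.
by rewrite pairD add0r => ->.
Qed.

(** A description of the graph in which the connection occurs only in [I1_coord]. *)
Lemma I1_graphP p v v' : ZU p ->
  I1_graph Q D p v v' <-> exists w : E, [/\ dot w.2 (tc p).2 = 0,
    v = TV p w & v' = TV p (I1_coord p w)].
Proof.
move=> zp; have [_ Up] := zp; have dy := Ux Up; have dyy := chart_at_dom p.1.
set a := (tc p).2.
have Gp Y : dot (Gam p.1 Y a) a = 0 := dot_conn_form m0 hD aJ Ux Y a Up.
have LK (z : 'cV[R]_m) : jac x0 p.1 p.1 *m (jac p.1 x0 p.1 *m z) = z.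
  by rewrite mulmxA (jacK dy dyy) mul1mx.
have KL (z : 'cV[R]_m) : jac p.1 x0 p.1 *m (jac x0 p.1 p.1 *m z) = z.
  by rewrite mulmxA (jacK dyy dy) mul1mx.
split=> [[W [Y [w [h [w' [h' [vW [[vw hh ->] [vw' hh' ->]]]]]]]]]|[w [wa -> ->]]].
  have [b ba WE] := (verticalP W zp).1 vW; rewrite {}WE in vw vw' *.
  rewrite (mul_vertical zp ba) in vw'.
  exists (jac p.1 x0 p.1 *m Y, b - Gam p.1 Y a); split.
  - by rewrite /= dotDl dotNl ba Gp subrr.
  - rewrite (is_vertical_Tvec zp vw) (is_hlift_Tvec zp hh).
    exact: Tvec_split.
  - rewrite (is_vertical_Tvec zp vw') (is_hlift_Tvec zp hh').
    rewrite (Tvec_split _ _ _ zp) /I1_coord /J_coord /=.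
    by rewrite LK -/a (subrK (Gam p.1 Y a) b).
pose Y := jac x0 p.1 p.1 *m w.1.
pose b := w.2 + Gam p.1 Y a.
have ba : dot b a = 0 by rewrite dotDl wa Gp addr0.
have wE : w = (jac p.1 x0 p.1 *m Y, b - Gam p.1 Y a).
  by rewrite /b addrK /Y KL; exact: surjective_pairing.
exists (comb J p.1 b), Y, (TV p (0, b)), (TV p (jac p.1 x0 p.1 *m Y, - Gam p.1 Y a)).
exists (TV p (0, cross a b)),
  (TV p (jac p.1 x0 p.1 *m (p.2 *m Y), - Gam p.1 (p.2 *m Y) a)).
split; first by apply/(verticalP _ zp); exists b.
split; split.
- exact: Tvec_is_vertical.
- exact: Tvec_is_hlift.
- by rewrite {1}wE (Tvec_split _ _ _ zp).
- by rewrite (mul_vertical zp ba); apply: Tvec_is_vertical; rewrite ?dot_cross.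
- exact: Tvec_is_hlift.
- by rewrite (Tvec_split _ _ _ zp).
Qed.

(** [I1] selects an element of the graph; there is one, and it is unique because the
coordinates of a vector are unique among those orthogonal to [a].  A radial
component of [w] changes neither side. *)
Lemma I1_Tvec p w : ZU p -> I1 Q D p (TV p w) = TV p (I1_coord p w).
Proof.
move=> zp; set a := (tc p).2; have a1 : dot a a = 1 := twistor_coord_unit m0 aJ Ux zp.
pose w0 : E := (w.1, w.2 - dot w.2 a *: a).
have w0a : dot w0.2 (tc p).2 = 0 by rewrite dotDl dotNl dotZl a1 mulr1 subrr.
have e1 : TV p w = TV p w0.
  have -> : w = w0 + dot w.2 a *: (0, a).
    rewrite [LHS]surjective_pairing /w0 -[_ *: (0, a)]/(_ *: 0, _ *: a) scaler0.
    by rewrite pairD addr0 subrK.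
  rewrite (TvecD m0 aJ Ux) // (TvecZ m0 aJ Ux) // (Tvec_radial m0 aJ Ux) //.
  apply/funext => f; transitivity (TV p w0 f + dot w.2 a * 0) => //.
  by rewrite mulr0 addr0.
have e2 : I1_coord p w = I1_coord p w0.
  rewrite /I1_coord /w0 /=; congr (_, _ - _).
  have cE u k : cross a (u - k *: a) = cross a u.
    apply/rowP; apply: ord3P; rewrite !crossE !mxE; ring.
  by rewrite -/a [in RHS]addrAC cE.
rewrite e1 e2 /I1.
have ex : exists v', I1_graph Q D p (TV p w0) v'.
  exists (TV p (I1_coord p w0)).
  exact: ((I1_graphP _ _ zp).2 (ex_intro _ w0 (And3 w0a erefl erefl))).
have [w' [w'a e ->]] := (I1_graphP _ _ zp).1 (getPex ex).
exact: (congr1 (fun u => TV p (I1_coord p u)) (esym (Tvec_inj m0 aJ Ux zp w0a w'a e))).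
Qed.

End Lifts.

(** * Brackets of vector fields on the twistor space *)

Section Brackets.
Context {R : realType} {m : nat} {M : manifold R m}.
Hypothesis m0 : (0 < m)%N.
Variables (Q : M -> set 'M[R]_m).
Local Notation ch := (@chart_at R m M).
Local Notation endo_pt := (M * 'M[R]_m)%type.
Local Notation E := ('cV[R]_m * 'rV[R]_3)%type.
Variables (x0 : M) (U : set M) (J : 'I_3 -> M -> 'M[R]_m).
Hypotheses (aJ : admissible_basis Q U J) (Ux : U `<=` cdom (ch x0)).
Local Notation tp := (twistor_pt x0 J).
Local Notation tc := (twistor_coord x0 J).
Local Notation td := (coord_dom x0 U J).
Local Notation ZU := (twistor_over Q U).
Local Notation TV := (Tvec Q x0 J).

Definition smooth_coords (S : set E) (A : E -> E) :=
  forall i, smooth_on S (fun q => pair_coord i (A q)).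

Lemma smooth_coords_diff S A q : smooth_coords S A -> S q -> differentiable A q.
Proof.
move=> sA Sq.
have d1 : differentiable (fun q => (A q).1) q.
  by apply: differentiable_cv => i; exact: (smooth_on_diff (sA (inl i)) Sq).
have d2 : differentiable (fun q => (A q).2) q.
  by apply: differentiable_rv => i; exact: (smooth_on_diff (sA (inr i)) Sq).
have -> : A = fun q => ((A q).1, (A q).2) by apply/funext => r; exact: surjective_pairing.
exact: differentiable_pair d1 d2.
Qed.

Lemma derive_expand (F : E -> R) (q w : E) : differentiable F q ->
  'D_w F q = \sum_i pair_coord i w * 'D_(pair_base i) F q.
Proof. by move=> dF; rewrite {1}(pair_coordE w) derive_suml. Qed.

Lemma field_smooth S A (F : E -> R) : open S -> smooth_coords S A ->
  smooth_on S F -> smooth_on S (fun q => 'D_(A q) F q).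
Proof.
move=> oS sA sF.
apply: (@smooth_on_eq _ _ _ _
  (fun q => \sum_i pair_coord i (A q) * 'D_(pair_base i) F q)) => //.
  by move=> q Sq; rewrite -derive_expand //; exact: smooth_on_diff sF Sq.
apply: smooth_on_sum => // i; apply: (smooth_on_mul oS (sA i)).
exact: (@smooth_on_derive _ _ _ _ _ (pair_base i) sF).
Qed.

(** Product rule; the term with second derivatives of [F] is put in the form of the
other field applied first, by symmetry of second derivatives. *)
Lemma derive_field S A (F : E -> R) q w : open S -> smooth_coords S A ->
  smooth_on S F -> S q ->
  'D_w (fun r => 'D_(A r) F r) q
    = 'D_(A q) (fun r => 'D_w F r) q + 'D_('D_w A q) F q.
Proof.
move=> oS sA sF Sq.
have dA := smooth_coords_diff sA Sq.
have dF := smooth_on_diff sF Sq.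
have sDF v : smooth_on S (fun r => 'D_v F r) := smooth_on_derive v sF.
have dDF v : differentiable (fun r => 'D_v F r) q := smooth_on_diff (sDF v) Sq.
have dAi i : differentiable (fun r => pair_coord i (A r)) q := smooth_on_diff (sA i) Sq.
have eD : 'D_w (fun r => 'D_(A r) F r) q
    = 'D_w (fun r => \sum_i pair_coord i (A r) * 'D_(pair_base i) F r) q.
  apply: near_eq_derive.
  have nS : nbhs q S by exact: open_nbhs_nbhs.
  apply: filterS nS => r Sr; apply: derive_expand.
  exact: (smooth_on_diff sF Sr).
have dm i : differentiable (fun r => pair_coord i (A r) * 'D_(pair_base i) F r) q.
  exact: (differentiableM (dAi i) (dDF (pair_base i))).
rewrite [LHS]eD [LHS](derive_sumf w dm).2.
rewrite (derive_expand (A q) (dDF w)) (derive_expand ('D_w A q) dF).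
have e1 i := smooth_derive_swap w (pair_base i) oS sF Sq.
have e2 i : 'D_w (fun r => pair_coord i (A r)) q = pair_coord i ('D_w A q).
  have lc := @pair_coord_diff R m 3 i (A q).
  by rewrite [LHS](derive_comp w dA lc) derive_pair_coord.
rewrite -big_split; apply: eq_bigr => i _.
rewrite [LHS](derive_mulf w (dAi i) (dDF (pair_base i))).
by rewrite [X in _ * X + _](e1 i) [X in _ + _ * X](e2 i) [X in _ + X]mulrC.
Qed.

Lemma coord_domS O O' q : O `<=` O' -> td O q -> td O' q.
Proof. by move=> OO [? ? ? /OO]. Qed.

(** On an open set of smoothness of [f] the truncation in [Tvec] is void. *)
Lemma field_apply O f A (X : endo_pt -> (endo_pt -> R) -> R) :
  twistor_open Q O -> O `<=` ZU -> twistor_smooth Q O f ->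
  (forall q, ZU q -> X q = TV q (A (tc q))) ->
  forall q, O q -> X q f = 'D_(A (tc q)) (f \o tp) (tc q).
Proof.
move=> oO OU sf XA q Oq; rewrite XA; last exact: OU.
by rewrite /Tvec at_smoothE //; exists O.
Qed.

Lemma field_twistor_vfield A (X : endo_pt -> (endo_pt -> R) -> R) :
  smooth_coords (td ZU) A ->
  (forall q, ZU q -> X q = TV q (A (tc q))) -> twistor_vfield Q ZU X.
Proof.
move=> sA XA; split=> [p zp|O f oO OU sf].
  by rewrite XA //; exact: (Tvec_tangent m0 aJ Ux).
apply: (coord_fun_smooth m0 aJ Ux oO OU (H := fun q => 'D_(A q) (f \o tp) q)).
  apply: field_smooth; first exact: (basis_dom_open (x := x0) aJ oO).
    by move=> i; apply: smooth_on_sub (sA i) => q; exact: coord_domS.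
  exact: (twistor_pt_smooth x0 aJ sf).
exact: (field_apply oO OU sf XA).
Qed.

(** The second derivatives of the function cancel, and what remains is the derivative
of the coordinates [A] in the constant direction [w]. *)
Lemma bracket_field A w (X Y : endo_pt -> (endo_pt -> R) -> R) p :
  smooth_coords (td ZU) A ->
  (forall q, ZU q -> X q = TV q (A (tc q))) ->
  (forall q, ZU q -> Y q = TV q w) -> ZU p ->
  dot (A (tc p)).2 (tc p).2 = 0 -> dot w.2 (tc p).2 = 0 ->
  bracket Q X Y p = TV p (- 'D_w A (tc p)).
Proof.
move=> sA XA Yw zp Ap wp; apply: at_smooth_eq => f sf.
have [V [oV Vp VU sfV]] := smooth_nearP m0 aJ zp sf.
have oS : open (td V) := basis_dom_open (x := x0) aJ oV.
have Sq : td V (tc p) := coord_dom_over m0 aJ Ux zp Vp.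
have sF : smooth_on (td V) (f \o tp) := twistor_pt_smooth x0 aJ sfV.
have sAV : smooth_coords (td V) A.
  by move=> i; apply: smooth_on_sub (sA i) => q; exact: coord_domS.
have XE := field_apply oV VU sfV XA.
have YE := @field_apply V f (fun _ => w) Y oV VU sfV Yw.
have sH1 := smooth_on_derive w sF.
have sH2 := field_smooth oS sAV sF.
rewrite XA // Yw //.
rewrite (Tvec_coord m0 aJ Ux oV VU sH1 YE Vp Ap).
rewrite (Tvec_coord m0 aJ Ux oV VU sH2 XE Vp wp).
rewrite [X in _ - X](derive_field w oS sAV sF Sq).
have cancel (b c : R) : b - (b + c) = - c by rewrite opprD addrA subrr add0r.
rewrite cancel -[- 'D_w A _]scaleN1r derive_scalel ?scaleN1r //.
exact: (smooth_on_diff sF Sq).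
Qed.

Lemma bracketC (X Y : endo_pt -> (endo_pt -> R) -> R) p :
  bracket Q X Y p = - bracket Q Y X p.
Proof.
apply/funext => f; rewrite /bracket /at_smooth.
transitivity (- (if pselect (smooth_near Q p f) then
  Y p (fun q => X q f) - X p (fun q => Y q f) else 0)) => //.
by case: pselect => sf; rewrite ?oppr0 ?opprB.
Qed.

Lemma smooth_near_base p k : ZU p ->
  smooth_near Q p (fun r => cmap (ch x0) r.1 k 0).
Proof.
move=> zp; exists ZU; split=> //; first exact: (over_open m0 aJ).
apply: (coord_fun_smooth m0 aJ Ux (over_open m0 aJ) (@subset_refl _ _)
  (H := fun q : E => q.1 k 0)) => //.
exact: smooth_on_fst_coord.
Qed.

(** A field applied to a base coordinate gives its own component, hence only first
derivatives of components occur. *)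
Lemma bracket_base A B (X Y : endo_pt -> (endo_pt -> R) -> R) p k :
  smooth_coords (td ZU) A -> smooth_coords (td ZU) B ->
  (forall q, ZU q -> X q = TV q (A (tc q))) ->
  (forall q, ZU q -> Y q = TV q (B (tc q))) -> ZU p ->
  dot (A (tc p)).2 (tc p).2 = 0 -> dot (B (tc p)).2 (tc p).2 = 0 ->
  bracket Q X Y p (fun r => cmap (ch x0) r.1 k 0)
   = 'D_(A (tc p)) (fun q => (B q).1 k 0) (tc p)
     - 'D_(B (tc p)) (fun q => (A q).1 k 0) (tc p).
Proof.
move=> sA sB XA YB zp Ap Bp.
rewrite /bracket at_smoothE; last exact: smooth_near_base.
have oZ := over_open m0 aJ.
have YE q : ZU q -> Y q (fun r => cmap (ch x0) r.1 k 0) = (B (tc q)).1 k 0.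
  by move=> zq; rewrite YB // (Tvec_base m0 aJ Ux).
have XE q : ZU q -> X q (fun r => cmap (ch x0) r.1 k 0) = (A (tc q)).1 k 0.
  by move=> zq; rewrite XA // (Tvec_base m0 aJ Ux).
rewrite XA // YB //.
rewrite (Tvec_coord m0 aJ Ux oZ (@subset_refl _ _) (sB (inl k)) YE zp Ap).
by rewrite (Tvec_coord m0 aJ Ux oZ (@subset_refl _ _) (sA (inl k)) XE zp Bp).
Qed.

End Brackets.

(** * Dependence of the almost complex structure on the point *)

Section Nijenhuis.
Context {R : realType} {m : nat} {M : manifold R m}.
Hypothesis m0 : (0 < m)%N.
Variables (Q : M -> set 'M[R]_m).
Local Notation ch := (@chart_at R m M).
Local Notation endo_pt := (M * 'M[R]_m)%type.
Local Notation E := ('cV[R]_m * 'rV[R]_3)%type.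
Variables (x0 : M) (U : set M) (J : 'I_3 -> M -> 'M[R]_m).
Hypotheses (aJ : admissible_basis Q U J) (Ux : U `<=` cdom (ch x0)).
Local Notation tp := (twistor_pt x0 J).
Local Notation tc := (twistor_coord x0 J).
Local Notation td := (coord_dom x0 U J).
Local Notation ZU := (twistor_over Q U).
Local Notation TV := (Tvec Q x0 J).

Let oU : open U. Proof. exact: (adm_open aJ). Qed.

(** [J_coord] as a function of the coordinates, extended linearly to all [a] in R^3. *)
Definition J_chart (q : E) (xi : 'cV[R]_m) : 'cV[R]_m :=
  \sum_i q.2 0 i *: (endo_chart x0 (J i) (cinv (ch x0) q.1) *m xi).

Lemma J_chart_linear q k xi zeta : J_chart q (k *: xi + zeta) = k *: J_chart q xi + J_chart q zeta.
Proof.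
rewrite /J_chart scaler_sumr -big_split; apply: eq_bigr => i _ /=.
by rewrite mulmxDr -scalemxAr scalerDr !scalerA [k * _]mulrC.
Qed.

Lemma J_chartE q xi y : cinv (ch x0) q.1 = y ->
  J_chart q xi = jac y x0 y *m (comb J y q.2 *m (jac x0 y y *m xi)).
Proof.
move=> <-; rewrite /comb mulmx_suml mulmx_sumr; apply: eq_bigr => i _.
by rewrite -scalemxAl -scalemxAr /endo_chart !mulmxA.
Qed.

Lemma cinv_twistor_coord p : ZU p -> cinv (ch x0) (tc p).1 = p.1.
Proof. by move=> [_ Up]; rewrite /= (cmapK (chart_atP x0) (Ux Up)). Qed.

Lemma J_coord_chart p xi : ZU p -> J_coord x0 p xi = J_chart (tc p) xi.
Proof.
move=> zp; rewrite (J_chartE _ (cinv_twistor_coord zp)).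
by rewrite (comb_twistor_coord m0 x0 aJ zp).
Qed.

Lemma coord_dom_over_open : open (td ZU).
Proof. exact: (basis_dom_open (x := x0) aJ (over_open m0 aJ)). Qed.

Lemma smooth_lift (g : M -> R) : smooth_fun U g ->
  smooth_on (td ZU) (fun q : E => g (cinv (ch x0) q.1)).
Proof.
move=> sg.
apply: (smooth_on_fst (p := 3) coord_dom_over_open (g := g \o cinv (ch x0))).
by apply: smooth_on_sub (sg x0) => u [a [iu Uu _ _]].
Qed.

Lemma J_chart_smooth xi k : smooth_on (td ZU) (fun q : E => J_chart q xi k 0).
Proof.
have oS := coord_dom_over_open.
apply: (@smooth_on_eq _ _ _ _ (fun q : E => \sum_i q.2 0 i *
    \sum_l endo_chart x0 (J i) (cinv (ch x0) q.1) k l * xi l 0)) => //.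
  move=> q _; rewrite summxE; apply: eq_bigr => i _.
  by rewrite [in RHS]mxE; congr (_ * _); rewrite [RHS]mxE.
apply: smooth_on_sum => // i; apply: (smooth_on_mul oS (@smooth_on_snd _ _ _ _ i)).
apply: smooth_on_sum => // l; apply: (smooth_on_mul oS); last exact: smooth_on_cst.
exact: (smooth_lift (endo_chart_smooth k l oU Ux (adm_smooth aJ i))).
Qed.

(** The derivative of a function linear in [a]. *)
Lemma derive_J_chart_fibre xi k p b : ZU p ->
  'D_(0, b) (fun q : E => J_chart q xi k 0) (tc p) = J_chart ((tc p).1, b) xi k 0.
Proof.
move=> zp; set q := tc p; set f := fun r : E => _; pose w : E := (0, b).
have df : differentiable f (q + (0 : R) *: w).
  rewrite scale0r addr0.
  exact: (smooth_on_diff (J_chart_smooth xi k) (coord_dom_over m0 aJ Ux zp zp)).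
have [_ e] := derive_line df; rewrite scale0r addr0 in e; rewrite -e.
set d := J_chart _ _ _ _.
have fE : (fun t : R => f (q + t *: w)) = fun t : R => f q + t *: d.
  apply/funext => t; rewrite /f /d /J_chart /= scaler0 addr0.
  rewrite !summxE scaler_sumr -big_split; apply: eq_bigr => i _ /=.
  by rewrite [(_ + t *: b) 0 i]mxE [(t *: b) 0 i]mxE scalerDl mxE -scalerA [X in _ + X]mxE.
rewrite fE; have [dl el] := is_diff_line (f q) d 0.
by rewrite (deriveE _ dl) el scale1r.
Qed.

Section OneConnection.
Variable D : M -> 'cV[R]_m -> (M -> 'cV[R]_m) -> 'cV[R]_m.
Hypothesis hD : quaternionic_connection Q D.
Local Notation Gam := (conn_form D x0 J).

Definition christoffel (k : 'I_m) (j : 'I_3) (y : M) : 'rV[R]_3 :=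
  coef (fun i => J i y) (nablaJ D x0 J j y (chart_field x0 (delta_mx k 0) y)).

(** [conn_form] as a function of the coordinates, extended linearly to all [a] in
R^3. *)
Definition conn_chart (q : E) (xi : 'cV[R]_m) : 'rV[R]_3 :=
  \sum_k xi k 0 *: \sum_j q.2 0 j *: christoffel k j (cinv (ch x0) q.1).

(** The image of the constant vector [(xi, 0)] by [I_1], as a function of the point. *)
Definition I1_chart (q : E) (xi : 'cV[R]_m) : E :=
  (J_chart q xi, cross q.2 (conn_chart q xi) - conn_chart q (J_chart q xi)).

Lemma conn_chart_linear q k xi zeta :
  conn_chart q (k *: xi + zeta) = k *: conn_chart q xi + conn_chart q zeta.
Proof.
rewrite /conn_chart scaler_sumr -big_split; apply: eq_bigr => i _ /=.
by rewrite !mxE scalerDl scalerA.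
Qed.

Lemma I1_chart_linear q k xi zeta :
  (I1_chart q (k *: xi + zeta)).2 = k *: (I1_chart q xi).2 + (I1_chart q zeta).2.
Proof.
rewrite /I1_chart /= J_chart_linear !conn_chart_linear crossDr crossZr scalerBr.
by rewrite opprD addrACA.
Qed.

Lemma conn_form_chart p xi : ZU p ->
  Gam p.1 (jac x0 p.1 p.1 *m xi) (tc p).2 = conn_chart (tc p) xi.
Proof.
move=> zp; have [_ Up] := zp; set a := (tc p).2.
have G0 : Gam p.1 0 a = 0.
  have := conn_form_linear hD aJ Ux (-1) 0 0 a Up.
  by rewrite scaler0 addr0 scaleN1r addNr.
have Gs s : Gam p.1 (\sum_(k <- s) xi k 0 *: (jac x0 p.1 p.1 *m delta_mx k 0)) a
    = \sum_(k <- s) xi k 0 *: Gam p.1 (jac x0 p.1 p.1 *m delta_mx k 0) a.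
  elim: s => [|k s IH]; first by rewrite !big_nil.
  by rewrite !big_cons (conn_form_linear hD aJ Ux _ _ _ a Up) IH.
rewrite {1}(cv_coordE xi) mulmx_sumr.
under eq_bigr do rewrite -scalemxAr.
rewrite Gs /conn_chart cinv_twistor_coord //; apply: eq_bigr => k _; congr (_ *: _).
Qed.

Lemma I1_coord_chart p xi : ZU p -> I1_coord D x0 J p (xi, 0) = I1_chart (tc p) xi.
Proof.
move=> zp; have [_ Up] := zp; have dy := Ux Up.
have LK (z : 'cV[R]_m) : jac x0 p.1 p.1 *m (jac p.1 x0 p.1 *m z) = z.
  by rewrite mulmxA (jacK dy (chart_at_dom p.1)) mul1mx.
have e : p.2 *m (jac x0 p.1 p.1 *m xi) = jac x0 p.1 p.1 *m J_chart (tc p) xi.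
  by rewrite -J_coord_chart // LK.
rewrite /I1_coord [X in (X, _)]J_coord_chart // /I1_chart add0r.
by rewrite e !conn_form_chart.
Qed.

Lemma conn_chart_smooth (v : E -> 'cV[R]_m) i :
  (forall k, smooth_on (td ZU) (fun q => v q k 0)) ->
  smooth_on (td ZU) (fun q => conn_chart q (v q) 0 i).
Proof.
move=> sv; have oS := coord_dom_over_open.
apply: (@smooth_on_eq _ _ _ _ (fun q : E => \sum_k v q k 0 *
    \sum_j q.2 0 j * christoffel k j (cinv (ch x0) q.1) 0 i)) => //.
  move=> q _; rewrite summxE; apply: eq_bigr => k _.
  rewrite [in RHS]mxE; congr (_ * _); rewrite summxE; apply: eq_bigr => j _.
  by rewrite [RHS]mxE.
apply: smooth_on_sum => // k; apply: (smooth_on_mul oS (sv k)).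
apply: smooth_on_sum => // j; apply: (smooth_on_mul oS (@smooth_on_snd _ _ _ _ j)).
exact: (smooth_lift (conn_form_smooth hD aJ Ux (delta_mx k 0) i j)).
Qed.

Lemma I1_chart_smooth xi : smooth_coords (td ZU) (I1_chart^~ xi).
Proof.
have oS := coord_dom_over_open.
have sG i : smooth_on (td ZU) (fun q => conn_chart q xi 0 i).
  by apply: conn_chart_smooth => k; exact: smooth_on_cst.
have sGJ i : smooth_on (td ZU) (fun q => conn_chart q (J_chart q xi) 0 i).
  by apply: conn_chart_smooth => k; exact: J_chart_smooth.
have sa i : smooth_on (td ZU) (fun q => q.2 0 i) := @smooth_on_snd R m 3 (td ZU) i.
have sc i j : smooth_on (td ZU) (fun q : E =>
    q.2 0 i * conn_chart q xi 0 j + - (q.2 0 j * conn_chart q xi 0 i)).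
  apply: smooth_on_add => //; first exact: smooth_on_mul.
  by apply: smooth_on_opp => //; exact: smooth_on_mul.
case=> [k|i]; first exact: J_chart_smooth.
apply: (@smooth_on_eq _ _ _ _ (fun q : E =>
    cross q.2 (conn_chart q xi) 0 i + - conn_chart q (J_chart q xi) 0 i)) => //.
  by move=> q _; rewrite /= [in RHS]mxE; congr (_ + _); rewrite [RHS]mxE.
apply: smooth_on_add => //; last by apply: smooth_on_opp.
elim/ord3P: i.
- by apply: smooth_on_eq (sc 1 2) => // q _; rewrite crossE.
- by apply: smooth_on_eq (sc 2 0) => // q _; rewrite crossE.
- by apply: smooth_on_eq (sc 0 1) => // q _; rewrite crossE.
Qed.

Lemma I1_chart_tangent xi p : ZU p -> dot (I1_chart (tc p) xi).2 (tc p).2 = 0.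
Proof.
move=> zp; have [_ Up] := zp.
rewrite /= dotDl dotNl dot_cross -(conn_form_chart _ zp).
by rewrite (dot_conn_form m0 hD aJ Ux _ _ Up) subrr.
Qed.

End OneConnection.

End Nijenhuis.

(** * The Nijenhuis tensor and uniqueness *)

Section Uniqueness.
Context {R : realType} {m : nat} {M : manifold R m}.
Hypothesis m0 : (0 < m)%N.
Variables (Q : M -> set 'M[R]_m).
Local Notation ch := (@chart_at R m M).
Local Notation endo_pt := (M * 'M[R]_m)%type.
Local Notation E := ('cV[R]_m * 'rV[R]_3)%type.
Local Notation conn := (M -> 'cV[R]_m -> (M -> 'cV[R]_m) -> 'cV[R]_m).
Variables (x0 : M) (U : set M) (J : 'I_3 -> M -> 'M[R]_m).
Hypotheses (aJ : admissible_basis Q U J) (Ux : U `<=` cdom (ch x0)).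
Local Notation tp := (twistor_pt x0 J).
Local Notation tc := (twistor_coord x0 J).
Local Notation td := (coord_dom x0 U J).
Local Notation ZU := (twistor_over Q U).
Local Notation TV := (Tvec Q x0 J).
Local Notation J_chart := (J_chart x0 J).

Definition base_dir (xi : 'cV[R]_m) : E := (xi, 0).

Lemma derive_J_chart_split xi k p w : ZU p ->
  'D_w (fun q : E => J_chart q xi k 0) (tc p)
   = 'D_(base_dir w.1) (fun q : E => J_chart q xi k 0) (tc p) + J_chart ((tc p).1, w.2) xi k 0.
Proof.
move=> zp; have e1 := derive_J_chart_fibre m0 aJ Ux xi k w.2 zp.
have df := smooth_on_diff (J_chart_smooth m0 aJ Ux xi k) (coord_dom_over m0 aJ Ux zp zp).
have e2 := derive_addl (base_dir w.1) (0, w.2) df.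
have e3 : base_dir w.1 + (0, w.2) = w.
  by rewrite /base_dir pairD addr0 add0r -surjective_pairing.
by rewrite e3 in e2; rewrite [LHS]e2 [X in _ + X]e1.
Qed.

(** The terms of the Nijenhuis tensor that depend only on the chart and on [J]. *)
Definition nijenhuis_frame (p : endo_pt) (xi zeta : 'cV[R]_m) (k : 'I_m) : R :=
  'D_(base_dir (J_chart (tc p) xi)) (fun q : E => J_chart q zeta k 0) (tc p)
  - 'D_(base_dir (J_chart (tc p) zeta)) (fun q : E => J_chart q xi k 0) (tc p)
  + J_chart (tc p) ('D_(base_dir zeta) (fun q : E => J_chart q xi) (tc p)) k 0
  - J_chart (tc p) ('D_(base_dir xi) (fun q : E => J_chart q zeta) (tc p)) k 0.

Lemma derive_fst (A : E -> E) (q w : E) : differentiable A q ->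
  ('D_w A q).1 = 'D_w (fun r => (A r).1) q.
Proof.
move=> dA; have dAi i : differentiable (fun r => (A r).1 i 0) q.
  exact: (differentiable_comp dA (@pair_coord_diff R m 3 (inl i) (A q))).
have d1 : differentiable (fun r => (A r).1) q by exact: differentiable_cv.
apply/matrixP => i j; rewrite ord1 (derive_entry w i 0 d1).
apply: (etrans (esym (derive_pair_coord (inl i) (A q) ('D_w A q)))).
exact: esym (derive_comp w dA (@pair_coord_diff R m 3 (inl i) (A q))).
Qed.

Lemma J_chartN q xi : J_chart q (- xi) = - J_chart q xi.
Proof.
have := J_chart_linear x0 J q (-1) xi 0; rewrite !scaleN1r addr0 => ->.
by rewrite (_ : J_chart q 0 = 0) ?addr0 // /J_chart big1 // => i _; rewrite mulmx0 scaler0.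
Qed.

Lemma nijenhuis_rearrange (a1 s1 a2 s2 c d : R) :
  a1 + s1 - (a2 + s2) - 0 - (- c) - d = 0 -> s1 - s2 + (a1 - a2 + c - d) = 0.
Proof. by move=> h; rewrite -[RHS]h; ring. Qed.

Lemma sub_common_part (s1 s2 t1 t2 n : R) :
  s1 - s2 + n = 0 -> t1 - t2 + n = 0 -> s2 - t2 = 0 -> s1 - t1 = 0.
Proof. by move=> h1 h2 h3; lra. Qed.

Lemma eval_sub4 (T : Type) (B1 B2 B3 B4 : (T -> R) -> R) g b1 b2 b3 b4 :
  B1 - B2 - B3 - B4 = 0 -> B1 g = b1 -> B2 g = b2 -> B3 g = b3 -> B4 g = b4 ->
  b1 - b2 - b3 - b4 = 0.
Proof. by move=> /(congr1 (fun B : (T -> R) -> R => B g)) h <- <- <- <-. Qed.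

(** The four brackets of the Nijenhuis tensor are computed for the fields with
coordinates [(xi, 0)] and [(zeta, 0)] and for their images by [I_1].  In
[I[IX, Y]] and [I[X, IY]] only base components matter, and these are given by
[J_chart], which does not involve [D]; in [[IX, IY]], the function
[J_chart _ zeta] is differentiated along [I1_chart _ xi], whose fibre component
involves [D]. *)
Lemma nijenhuis_base (D : conn) p xi zeta k : quaternionic_connection Q D ->
  acs_integrable Q (I1 Q D) -> ZU p ->
  J_chart ((tc p).1, (I1_chart x0 J D (tc p) xi).2) zeta k 0
  - J_chart ((tc p).1, (I1_chart x0 J D (tc p) zeta).2) xi k 0
  + nijenhuis_frame p xi zeta k = 0.
Proof.
move=> hD hI zp; set q := tc p.
pose X xi (r : endo_pt) := TV r (base_dir xi).
pose A xi (r : E) := I1_chart x0 J D r xi.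
pose IX xi r := I1 Q D r (X xi r).
have sX u : smooth_coords (td ZU) (fun _ : E => base_dir u).
  by move=> i; exact: smooth_on_cst.
have sA u : smooth_coords (td ZU) (A u) := I1_chart_smooth m0 aJ Ux hD u.
have XE u r : ZU r -> X u r = TV r (base_dir u) by [].
have IXE u r : ZU r -> IX u r = TV r (A u (tc r)).
  move=> zr; rewrite /IX /X (I1_Tvec m0 hD aJ Ux _ zr).
  by rewrite (I1_coord_chart m0 aJ Ux hD u zr).
have Aa u : dot (A u q).2 q.2 = 0 := I1_chart_tangent m0 aJ Ux hD u zp.
have Xa u : dot (base_dir u).2 q.2 = 0 by rewrite /= dotE !mxE !mul0r !addr0.
have dA u : differentiable (A u) q.
  exact: (smooth_coords_diff (sA u) (coord_dom_over m0 aJ Ux zp zp)).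
have vX u : twistor_vfield Q ZU (X u).
  exact: (field_twistor_vfield m0 aJ Ux (sX u) (XE u)).
have hN : bracket Q (IX xi) (IX zeta) p - bracket Q (X xi) (X zeta) p
    - I1 Q D p (bracket Q (IX xi) (X zeta) p)
    - I1 Q D p (bracket Q (X xi) (IX zeta) p) = 0.
  exact: (hI _ _ _ (over_open m0 aJ) (vX xi) (vX zeta) p zp).
have b1 := bracket_base m0 aJ Ux k (sA xi) (sA zeta) (IXE xi) (IXE zeta) zp
  (Aa xi) (Aa zeta).
have b2 := bracket_field m0 aJ Ux (sX xi) (XE xi) (XE zeta) zp (Xa xi) (Xa zeta).
have b3 := bracket_field m0 aJ Ux (sA xi) (IXE xi) (XE zeta) zp (Aa xi) (Xa zeta).
have b4 := bracket_field m0 aJ Ux (sA zeta) (IXE zeta) (XE xi) zp (Aa zeta) (Xa xi).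
have b4' : bracket Q (X xi) (IX zeta) p = TV p ('D_(base_dir xi) (A zeta) q).
  apply: (etrans (bracketC _ _ _ _)); apply: (etrans (congr1 -%R b4)).
  apply: (etrans (congr1 -%R (TvecN m0 aJ Ux _ zp))); exact: opprK.
have b3' := etrans (congr1 (I1 Q D p) b3) (I1_Tvec m0 hD aJ Ux _ zp).
have {}b4' := etrans (congr1 (I1 Q D p) b4') (I1_Tvec m0 hD aJ Ux _ zp).
have base w := Tvec_base m0 aJ Ux w k zp.
set g := fun r : endo_pt => _ in base b1.
have v2 := etrans (congr1 (fun v : (endo_pt -> R) -> R => v g) b2) (base _).
have v3 := etrans (congr1 (fun v : (endo_pt -> R) -> R => v g) b3') (base _).
have v4 := etrans (congr1 (fun v : (endo_pt -> R) -> R => v g) b4') (base _).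
have w1 := etrans b1 (f_equal2 (fun a b : R => a - b)
  (derive_J_chart_split zeta k (A xi q) zp) (derive_J_chart_split xi k (A zeta q) zp)).
have w2 : bracket Q (X xi) (X zeta) p g = 0.
  apply: (etrans v2).
  have -> : 'D_(base_dir zeta) (fun _ : E => base_dir xi) q = 0.
    exact: (derive_cst (base_dir xi)).
  by rewrite oppr0 mxE.
have e3 u z : ('D_(base_dir z) (A u) q).1 = 'D_(base_dir z) (fun r : E => J_chart r u) q.
  exact: (derive_fst (base_dir z) (dA u)).
have Jb w : (I1_coord D x0 J p w).1 k 0 = J_chart q w.1 k 0.
  exact: (congr1 (fun v : 'cV[R]_m => v k 0) (J_coord_chart m0 aJ Ux w.1 zp)).
have w3 := etrans v3 (Jb _).
have w4 := etrans v4 (Jb _).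
have w3' : I1 Q D p (bracket Q (IX xi) (X zeta) p) g
    = - J_chart q ('D_(base_dir zeta) (fun r : E => J_chart r xi) q) k 0.
  apply: (etrans w3); rewrite -(e3 xi zeta).
  by rewrite (_ : (- _).1 = - ('D_(base_dir zeta) (A xi) q).1) // J_chartN mxE.
rewrite e3 in w4.
exact: (nijenhuis_rearrange (eval_sub4 hN w1 w2 w3' w4)).
Qed.

Lemma rV3_valued_kernel (v : 'cV[R]_m -> 'rV[R]_3) : (3 < m)%N ->
  (forall k xi zeta, v (k *: xi + zeta) = k *: v xi + v zeta) ->
  exists2 zeta, zeta != 0 & v zeta = 0.
Proof.
move=> m3 lv; pose B : 'M[R]_(m, 3) := \matrix_(k, i) v (delta_mx k 0) 0 i.
have v0 : v 0 = 0.
  by have := lv (-1) 0 0; rewrite scaler0 addr0 scaleN1r addNr.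
have vs s (xi : 'cV[R]_m) : v (\sum_(k <- s) xi k 0 *: delta_mx k 0)
    = \sum_(k <- s) xi k 0 *: v (delta_mx k 0).
  by elim: s => [|k s IH]; rewrite ?big_nil // !big_cons lv IH.
have kB : kermx B != 0.
  rewrite kermx_eq0 /row_free neq_ltn; apply/orP; left.
  exact: leq_ltn_trans (rank_leq_col B) m3.
have /rowV0Pn [z /sub_kermxP zB z0] := kB.
exists z^T; first by rewrite -(inj_eq (@trmx_inj _ _ _)) trmxK trmx0.
rewrite (cv_coordE z^T) vs; apply/rowP => i.
have /rowP/(_ i) := zB; rewrite !mxE summxE => e; rewrite -[RHS]e.
by apply: eq_bigr => k _; rewrite /cv_coord !mxE.
Qed.

Lemma sub_lincomb (k : R) (a a' b b' : 'rV[R]_3) :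
  (k *: a + b) - (k *: a' + b') = k *: (a - a') + (b - b').
Proof. by rewrite scalerBr opprD addrACA. Qed.

Lemma comb_faithful y (b : 'rV[R]_3) (w : 'cV[R]_m) : U y -> w != 0 ->
  comb J y b *m w = 0 -> b = 0.
Proof.
move=> Uy w0 h; have := congr1 (mulmx (comb J y b)) h.
rewrite mulmxA (adm_quat_mul aJ) // mulmx0 crossvv.
rewrite comb0 addr0 mulNmx mul_scalar_mx => /eqP.
rewrite oppr_eq0 scaler_eq0 (negbTE w0) orbF => /eqP b0.
apply/eqP; apply: contraT => /dot_gt0; by rewrite b0 ltxx.
Qed.

(** The difference [v] of the two sides, as a function of [xi], satisfies
[J_(v xi) zeta = J_(v zeta) xi] by [nijenhuis_base].  For [zeta <> 0] in the kernel of
[v] this gives [J_(v xi) zeta = 0], and [J_(v xi)] is injective unless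
[v xi = 0]. *)
Lemma I1_chart_uniq (D D' : conn) p xi : (3 < m)%N ->
  quaternionic_connection Q D -> quaternionic_connection Q D' ->
  acs_integrable Q (I1 Q D) -> acs_integrable Q (I1 Q D') -> ZU p ->
  (I1_chart x0 J D (tc p) xi).2 = (I1_chart x0 J D' (tc p) xi).2.
Proof.
move=> m3 hD hD' hI hI' zp; have [_ Up] := zp; have dy := Ux Up.
pose v u := (I1_chart x0 J D (tc p) u).2 - (I1_chart x0 J D' (tc p) u).2.
have lv k u z : v (k *: u + z) = k *: v u + v z.
  have e1 := I1_chart_linear x0 J D (tc p) k u z.
  have e2 := I1_chart_linear x0 J D' (tc p) k u z.
  apply: (etrans (f_equal2 (fun a b : 'rV[R]_3 => a - b) e1 e2)).
  exact: sub_lincomb.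
have [zeta z0 vz] := rV3_valued_kernel m3 lv.
have JqB a b u k : J_chart ((tc p).1, a - b) u k 0
    = J_chart ((tc p).1, a) u k 0 - J_chart ((tc p).1, b) u k 0.
  rewrite /J_chart !summxE -sumrB; apply: eq_bigr => i _ /=.
  rewrite [LHS]mxE [X in _ = X - _]mxE [X in _ = _ - X]mxE.
  by rewrite [X in X * _]mxE [X in (_ + X) * _]mxE mulrBl.
have key k : J_chart ((tc p).1, v xi) zeta k 0 = 0.
  have e1 := nijenhuis_base xi zeta k hD hI zp.
  have e2 := nijenhuis_base xi zeta k hD' hI' zp.
  have e3 : J_chart ((tc p).1, v zeta) xi k 0 = 0.
    rewrite vz /J_chart summxE big1 // => i _; by rewrite /= !mxE mul0r.
  rewrite /v JqB; rewrite /v JqB in e3; exact: (sub_common_part e1 e2 e3).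
have {}key : J_chart ((tc p).1, v xi) zeta = 0.
  by apply/matrixP => k j; rewrite ord1 key mxE.
have ey : cinv (ch x0) ((tc p).1, v xi).1 = p.1 by exact: (cinv_twistor_coord J Ux zp).
rewrite (J_chartE J zeta ey) in key.
set y := p.1 in key Up dy *.
have LK (z : 'cV[R]_m) : jac x0 y y *m (jac y x0 y *m z) = z.
  by rewrite mulmxA (jacK dy (chart_at_dom y)) mul1mx.
have KL (z : 'cV[R]_m) : jac y x0 y *m (jac x0 y y *m z) = z.
  by rewrite mulmxA (jacK (chart_at_dom y) dy) mul1mx.
have {}key := congr1 (mulmx (jac x0 y y)) key.
rewrite LK mulmx0 in key.
apply: subr0_eq; apply: (comb_faithful Up _ key).
by apply: contra_neq z0 => w0; rewrite -(KL zeta) w0 mulmx0.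
Qed.

(** [I1] is a choice in its graph, so it suffices that both connections have the same
graph; by [I1_graphP] this reduces to the equality of the functions [I1_coord],
and by linearity to their values on the vectors [(xi, 0)]. *)
Lemma I1_uniq (D D' : conn) p v : (3 < m)%N ->
  quaternionic_connection Q D -> quaternionic_connection Q D' ->
  acs_integrable Q (I1 Q D) -> acs_integrable Q (I1 Q D') -> ZU p ->
  I1 Q D p v = I1 Q D' p v.
Proof.
move=> m3 hD hD' hI hI' zp.
have I1_coordE (D0 : conn) w : I1_coord D0 x0 J p w
    = (J_coord x0 p w.1, cross (tc p).2 w.2 + (I1_coord D0 x0 J p (w.1, 0)).2).
  by rewrite /I1_coord /= add0r crossDr addrA.
have e w : I1_coord D x0 J p w = I1_coord D' x0 J p w.
  have e2 : (I1_coord D x0 J p (w.1, 0)).2 = (I1_coord D' x0 J p (w.1, 0)).2.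
    apply: (etrans (congr1 snd (I1_coord_chart m0 aJ Ux hD w.1 zp))).
    apply: (etrans (I1_chart_uniq w.1 m3 hD hD' hI hI' zp)).
    exact: (esym (congr1 snd (I1_coord_chart m0 aJ Ux hD' w.1 zp))).
  apply: (etrans (I1_coordE D w)); apply: (etrans _ (esym (I1_coordE D' w))).
  exact: (congr1 (fun b => (J_coord x0 p w.1, cross (tc p).2 w.2 + b)) e2).
rewrite /I1; congr (get _); apply/funext => v'; apply/propext.
split=> /(I1_graphP m0 _ aJ Ux _ _ zp) => [/(_ hD)|/(_ hD')] [w [wa vE vE']].
  by apply/(I1_graphP m0 hD' aJ Ux _ _ zp); exists w; rewrite -e.
by apply/(I1_graphP m0 hD aJ Ux _ _ zp); exists w; rewrite e.
Qed.

End Uniqueness.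

Lemma admissible_basis_restrict (R : realType) (m : nat) (M : manifold R m)
    (Q : M -> set 'M[R]_m) U V J : open V -> admissible_basis Q U J ->
  admissible_basis Q (U `&` V) J.
Proof.
move=> oV [oU sJ sq J12 J21 span]; split.
- exact: openI.
- by move=> i; apply: smooth_endo_sub (sJ i) => y [].
- by move=> i y [Uy _]; exact: sq.
- by move=> y [Uy _]; exact: J12.
- by move=> y [Uy _]; exact: J21.
- by move=> y [Uy _]; exact: span.
Qed.

Theorem corollary3p9 (R : realType) (n : nat) (hn : (1 <= n)%N)
    (M : manifold R (4 * n)%N) (Q : M -> set 'M[R]_(4 * n)%N)
    (hQ : almost_quaternionic Q)
    (D D' : M -> 'cV[R]_(4 * n)%N -> (M -> 'cV[R]_(4 * n)%N) -> 'cV[R]_(4 * n)%N)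
    (hD : quaternionic_connection Q D) (hD' : quaternionic_connection Q D')
    (hI : acs_integrable Q (I1 Q D)) (hI' : acs_integrable Q (I1 Q D')) :
  forall p, twistor Q p -> forall v, tangent Q p v ->
    I1 Q D p v = I1 Q D' p v.
Proof.
move=> p tw v _.
have m3 : (3 < 4 * n)%N by rewrite (leq_trans _ (leq_mul (leqnn 4) hn)).
have m0 : (0 < 4 * n)%N by rewrite (leq_trans _ m3).
have [U [J [Up aJ]]] := hQ p.1.
have aJ' := admissible_basis_restrict (@chart_dom_open _ _ _ p.1) aJ.
exact: (I1_uniq m0 aJ' (@subIsetr _ _ _) v m3 hD hD' hI hI'
  (conj tw (conj Up (chart_at_dom p.1)))).
Qed.
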